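(* Let $\kappa$ be a consistent (positive definite) kernel on $\mathbf X$, $g:\mathbf X\to(0,\infty)$ continuous, $a=(a_i)_{i\in I}$ with all $a_i>0$, and $\mathcal A=(A_i)_{i\in I}$ an $(m,p)$-condenser with $\mathrm{cap}\,(\mathcal A,a,g)>0$. Assume that either $I^-=\varnothing$, or both $\inf_{x\in A}g(x)>0$ and $\sup_{x\in A^+,\,y\in A^-}\kappa(x,y)<\infty$. Let $\hat\Gamma(\mathcal A,a,g)$ be the class of all $\nu\in\mathcal E$ for which there exist real numbers $c_i(\nu)$, $i\in I$, with $\alpha_ia_i\kappa(x,\nu)\geqslant c_i(\nu)g(x)$ n.e. in $A_i$ for all $i\in I$ and $\sum_{i\in I}c_i(\nu)\geqslant1$, assume $\|\hat\Gamma(\mathcal A,a,g)\|^2<\infty$, and let $\hat{\mathcal G}(\mathcal A,a,g)$ be the collection of all $\hat\omega\in\hat\Gamma(\mathcal A,a,g)$ with $\|\hat\omega\|^2=\|\hat\Gamma(\mathcal A,a,g)\|^2$. If such an $\hat\omega$ exists, then $\hat{\mathcal G}(\mathcal A,a,g)$ forms an equivalence class in $\mathcal E$ (i.e. $\hat{\mathcal G}(\mathcal A,a,g)=\{\nu\in\mathcal E:\|\nu-\hat\omega\|=0\}$).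
   Context: $\mathbf X$ is a locally compact Hausdorff space; $\mathfrak M$ is the space of all real-valued (signed) Radon measures on $\mathbf X$ with the vague topology (pointwise convergence on continuous real functions with compact support). A kernel is a lower semicontinuous $\kappa:\mathbf X\times\mathbf X\to(-\infty,\infty]$, assumed $\geqslant0$ unless $\mathbf X$ is compact. Write $\kappa(\nu,\nu_1)=\int\kappa\,d(\nu\otimes\nu_1)$ (mutual energy; energy if $\nu_1=\nu$) and $\kappa(x,\nu)=\int\kappa(x,y)\,d\nu(y)$ (potential) whenever well defined. $\mathcal E$ is the set of $\nu\in\mathfrak M$ with finite energy. $\kappa$ is positive definite: symmetric with $\kappa(\nu,\nu)\geqslant0$ whenever defined; then $\mathcal E$ is a pre-Hilbert space with scalar product $\kappa(\nu,\nu_1)$ and seminorm $\|\nu\|=\kappa(\nu,\nu)^{1/2}$, defining the strong topology; $\nu,\nu_0\in\mathcal E$ are equivalent in $\mathcal E$ if $\|\nu-\nu_0\|=0$. A nonnegative measure is concentrated on $E\subset\mathbf X$ if $\mathbf X\setminus E$ is locally negligible for it; $\mathfrak M^+(E)$ is the set of such measures, $\mathcal E^+(E)=\mathfrak M^+(E)\cap\mathcal E$, $\mathcal E^+=\mathcal E^+(\mathbf X)$. $\kappa$ is consistent if every strong Cauchy net in $\mathcal E^+$ converges strongly to each of its vague cluster points. Interior capacity of a set: $C(E)=1/\inf\{\|\nu\|^2:\nu\in\mathcal E^+(E),\ \nu(\mathbf X)=1\}$. A relation holds n.e. (nearly everywhere) in $E$ if the set of $x\in E$ where it fails has interior capacity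 zero; for $\nu\in\mathcal E$ the potential $\kappa(\cdot,\nu)$ is defined and finite n.e. in $\mathbf X$. Conventions: $\inf\varnothing=+\infty$, $1/0=+\infty$, $1/(+\infty)=0$. Fix integers $m\geqslant1$, $p\geqslant0$; $I=\{1,\dots,m+p\}$, $I^+=\{1,\dots,m\}$, $I^-=I\setminus I^+$; $\alpha_i=+1$ for $i\in I^+$, $\alpha_i=-1$ for $i\in I^-$. An $(m,p)$-condenser is an ordered collection $\mathcal A=(A_i)_{i\in I}$ of nonempty subsets of $\mathbf X$ with $\overline{A_i}\cap\overline{A_j}=\varnothing$ for all $i\in I^+$, $j\in I^-$. $A=\bigcup_{i\in I}A_i$, $A^+=\bigcup_{i\in I^+}A_i$, $A^-=\bigcup_{i\in I^-}A_i$. $\mathfrak M(\mathcal A)$ is the set of formal combinations $\mu=\sum_{i\in I}\alpha_i\mu^i$ with $\mu^i\in\mathfrak M^+(A_i)$, identified with tuples $(\mu^i)_{i\in I}$; $R\mu\in\mathfrak M$ is the signed measure $\sum_i\alpha_i\mu^i$; $\mathcal E(\mathcal A)$ is the set of $\mu\in\mathfrak M(\mathcal A)$ with finite energy $\|\mu\|^2:=\kappa(R\mu,R\mu)$. $\mathcal E(\mathcal A,a,g)=\{\mu\in\mathcal E(\mathcal A):\int g\,d\mu^i=a_i\ \forall i\in I\}$. For a set $\mathcal H$ in $\mathcal E$ or $\mathcal E(\mathcal A)$, $\|\mathcal H\|^2:=\inf_{\nu\in\mathcal H}\|\nu\|^2$. $\mathrm{cap}\,(\mathcal A,a,g):=1/\|\mathcal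 E(\mathcal A,a,g)\|^2$. *)

(* Defs.v *)
From HB Require Import structures.
From mathcomp Require Import all_boot all_order all_algebra.
From mathcomp Require Import all_classical all_reals all_analysis.

Set Implicit Arguments.
Unset Strict Implicit.
Unset Printing Implicit Defensive.

Import Order.TTheory GRing.Theory Num.Theory.
Import numFieldNormedType.Exports.

Local Open Scope classical_set_scope.
Local Open Scope ring_scope.

(* On a locally compact Hausdorff space that need not be sigma-compact, a
   signed Radon measure need not be a [charge] (both its parts may have
   infinite mass), and a lower semicontinuous function on X * X need not be
   measurable for the product of the Borel sigma-algebras.  Radon measures are
   therefore taken in Bourbaki's sense, as functionals on the space Cc of
   continuous functions with compact support, with Bourbaki's integral. *)

Section radon.
Context {R : realType} {T : topologicalType}.
Implicit Types (f h : T -> R) (F H : T -> \bar R) (nu mu : (T -> R) -> R).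

Definition Cc : set (T -> R) :=
  [set f | continuous f /\ compact (closure [set x | f x != 0])].

(* A functional on Cc is encoded as a functional on all of T -> R that vanishes
   outside Cc, so that equality of measures is equality of functionals. *)
Definition on_Cc nu : (T -> R) -> R := fun f => if `[< Cc f >] then nu f else 0.

(* Linear functionals on Cc, continuous for its inductive limit topology. *)
Definition radon : set ((T -> R) -> R) :=
  [set nu | [/\ forall f, ~ Cc f -> nu f = 0,
    forall (c : R) f h, Cc f -> Cc h ->
      nu (fun x => c * f x + h x) = c * nu f + nu h
  & forall K : set T, compact K -> exists M : R, forall f (b : R), Cc f ->
      closure [set x | f x != 0] `<=` K -> (forall x, `|f x| <= b) ->
      `|nu f| <= M * b]].

Definition radon_pos : set ((T -> R) -> R) :=
  [set nu | radon nu /\ forall f, Cc f -> (forall x, 0 <= f x) -> 0 <= nu f].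

(* Jordan decomposition nu = jpos nu - jneg nu: on nonnegative f in Cc,
   jpos nu f is the supremum of nu h over h in Cc with 0 <= h <= f. *)
Definition jsup nu f : R :=
  sup [set nu h | h in [set h | Cc h /\ forall x, 0 <= h x <= f x]].

Definition jpos nu : (T -> R) -> R := on_Cc (fun f => jsup nu f^\+ - jsup nu f^\-).

Definition jneg nu : (T -> R) -> R := jpos (\- nu).

(* Integral, against a positive measure mu, of a lower semicontinuous
   F : T -> ]-oo, +oo] which is nonnegative or whose domain T is compact; only
   ever applied to such F. *)
Definition lsc_integral mu F : \bar R :=
  ereal_sup [set (mu f)%:E | f in [set f | Cc f /\ forall x, ((f x)%:E <= F x)%E]].

(* The same against a signed measure: it is well defined unless it is of the
   form +oo - +oo (the two terms are never -oo). *)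
Definition integral_def nu F : Prop :=
  (lsc_integral (jpos nu) F < +oo)%E \/ (lsc_integral (jneg nu) F < +oo)%E.

Definition signed_integral nu F : \bar R :=
  (lsc_integral (jpos nu) F - lsc_integral (jneg nu) F)%E.

(* Upper integral of an arbitrary nonnegative function. *)
Definition upper_integral mu F : \bar R :=
  ereal_inf [set lsc_integral mu H | H in
    [set H | lower_semicontinuous H /\ forall x, (0 <= H x)%E /\ (F x <= H x)%E]].

Definition negligible_for mu (N : set T) : Prop :=
  upper_integral mu (EFin \o \1_N) = 0%E.

Definition locally_negligible mu (N : set T) : Prop :=
  forall K : set T, compact K -> negligible_for mu (N `&` K).

(* M^+(E) *)
Definition radon_on (E : set T) : set ((T -> R) -> R) :=
  [set mu | radon_pos mu /\ locally_negligible mu (~` E)].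

(* The vague topology is the initial topology for this map. *)
Definition vague nu : {ptws {phi : T -> R | Cc phi} -> R} :=
  fun phi => nu (sval phi).

End radon.

Arguments Cc R T : clear implicits.
Arguments radon R T : clear implicits.
Arguments radon_pos R T : clear implicits.

Definition directed (D : Type) (le : D -> D -> Prop) : Prop :=
  [/\ inhabited D, forall d, le d d,
      forall d e f, le d e -> le e f -> le d f
    & forall d e, exists f, le d f /\ le e f].

Definition tails (D : Type) (le : D -> D -> Prop) : set_system D :=
  [set S | exists d, forall e, le d e -> S e].

Section potential.
Context {R : realType} {X : topologicalType}.
Implicit Types (k : X * X -> \bar R) (nu mu : (X -> R) -> R) (E : set X).

Definition energy_kernel k : Prop :=
  [/\ lower_semicontinuous k, forall z, k z != -oo%E
    & compact [set: X] \/ forall z, (0 <= k z)%E].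

Definition product_measure nu mu : (X * X -> R) -> R :=
  on_Cc (fun f => nu (fun x => mu (fun y => f (x, y)))).

Definition potential_def k nu (x : X) : Prop :=
  integral_def nu (fun y => k (x, y)).

Definition potential k nu (x : X) : \bar R :=
  signed_integral nu (fun y => k (x, y)).

Definition energy_def k nu mu : Prop := integral_def (product_measure nu mu) k.

Definition energy k nu mu : \bar R := signed_integral (product_measure nu mu) k.

(* The seminorm and its square; used only for measures in finite_energy k,
   which is a linear space when k is positive definite. *)
Definition knorm2 k nu : \bar R := energy k nu nu.

Definition knorm k nu : \bar R := sqrte (knorm2 k nu).

Definition finite_energy k : set ((X -> R) -> R) :=
  [set nu | [/\ radon R X nu, energy_def k nu nu & energy k nu nu \is a fin_num]].

(* E^+(E) *)
Definition finite_energy_on k E : set ((X -> R) -> R) :=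
  radon_on E `&` finite_energy k.

Definition positive_definite k : Prop :=
  (forall x y, k (x, y) = k (y, x)) /\
  (forall nu, radon R X nu -> energy_def k nu nu -> (0 <= energy k nu nu)%E).

Definition strong_cauchy k (D : Type) (le : D -> D -> Prop)
    (nu : D -> (X -> R) -> R) : Prop :=
  forall e : R, 0 < e -> exists d, forall s t, le d s -> le d t ->
    (knorm k (nu s \- nu t)%R < e%:E)%E.

Definition strong_cvg k (D : Type) (le : D -> D -> Prop)
    (nu : D -> (X -> R) -> R) (nu0 : (X -> R) -> R) : Prop :=
  finite_energy k nu0 /\
  forall e : R, 0 < e -> exists d, forall s, le d s ->
    (knorm k (nu s \- nu0)%R < e%:E)%E.

Definition vague_cluster (D : Type) (le : D -> D -> Prop)
    (nu : D -> (X -> R) -> R) (nu0 : (X -> R) -> R) : Prop :=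
  radon R X nu0 /\ cluster ((fun d => vague (nu d)) @ tails le) (vague nu0).

Definition consistent k : Prop :=
  positive_definite k /\
  forall (D : Type) (le : D -> D -> Prop) (nu : D -> (X -> R) -> R),
    directed le -> (forall d, finite_energy_on k [set: X] (nu d)) ->
    strong_cauchy k le nu ->
    forall nu0, vague_cluster le nu nu0 -> strong_cvg k le nu nu0.

(* ||H||^2 *)
Definition inf_energy k (H : set ((X -> R) -> R)) : \bar R :=
  ereal_inf [set knorm2 k nu | nu in H].

(* Extended-real inversion has 0^-1 = +oo and +oo^-1 = 0. *)
Definition interior_capacity k E : \bar R :=
  (inf_energy k [set nu | finite_energy_on k E nu /\
                          lsc_integral nu (cst 1%E) = 1%E])^-1%E.

Definition nearly_everywhere k E (P : X -> Prop) : Prop :=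
  interior_capacity k [set x | E x /\ ~ P x] = 0%E.

End potential.

Section condenser.
Context {R : realType} {X : topologicalType} {m p : nat}.
Implicit Types (k : X * X -> \bar R) (A : 'I_(m + p) -> set X)
  (a : 'I_(m + p) -> R) (g : X -> R) (mu : 'I_(m + p) -> (X -> R) -> R).

(* The first m indices are the positive ones, the last p the negative ones. *)
Definition alpha (i : 'I_(m + p)) : R := if (i < m)%N then 1 else -1.

Definition condenser A : Prop :=
  (forall i, A i !=set0) /\
  (forall i j : 'I_(m + p), (i < m)%N -> (m <= j)%N ->
     closure (A i) `&` closure (A j) = set0).

Definition plates A : set X := \bigcup_i A i.
Definition plates_pos A : set X := \bigcup_(i in [set i : 'I_(m + p) | (i < m)%N]) A i.
Definition plates_neg A : set X := \bigcup_(i in [set i : 'I_(m + p) | (m <= i)%N]) A i.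

(* The signed measure R mu *)
Definition signed_resultant mu : (X -> R) -> R := fun f => \sum_i alpha i * mu i f.

(* E(A, a, g) *)
Definition admissible k A a g : set ('I_(m + p) -> (X -> R) -> R) :=
  [set mu | [/\ forall i, radon_on (A i) (mu i),
                finite_energy k (signed_resultant mu)
              & forall i, lsc_integral (mu i) (EFin \o g) = (a i)%:E]].

Definition condenser_capacity k A a g : \bar R :=
  (ereal_inf [set knorm2 k (signed_resultant mu) | mu in admissible k A a g])^-1%E.

Definition Gamma_hat k A a g : set ((X -> R) -> R) :=
  [set nu | finite_energy k nu /\
    exists c : 'I_(m + p) -> R,
      (forall i, nearly_everywhere k (A i) (fun x => potential_def k nu x /\
         ((alpha i * a i)%:E * potential k nu x >= (c i * g x)%:E)%E)) /\
      \sum_i c i >= 1].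

Definition G_hat k A a g : set ((X -> R) -> R) :=
  [set omega | Gamma_hat k A a g omega /\
               knorm2 k omega = inf_energy k (Gamma_hat k A a g)].

End condenser.

(* Main.v *)
Require Import Defs.
From HB Require Import structures.
From mathcomp Require Import all_boot all_order all_algebra.
From mathcomp Require Import all_classical all_reals all_analysis.
From mathcomp Require Import ring lra.
Import Order.TTheory GRing.Theory Num.Theory.
Import numFieldNormedType.Exports.
Local Open Scope classical_set_scope.
Local Open Scope ring_scope.

Set Implicit Arguments.
Unset Strict Implicit.
Unset Printing Implicit Defensive.

(* As k is positive definite, the energy is a nonnegative quadratic form on the
   measures of finite energy: mutual energies are finite, as otherwise
   k(nu - tau, nu - tau) = -oo.  Hence, Gamma_hat being convex, the parallelogram
   law makes any two minimizers equivalent.  Conversely, if ||nu - omega|| = 0,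
   Cauchy-Schwarz gives the integral of k(., nu - omega) against every positive
   measure of finite energy the value 0, so that the two potentials agree nearly
   everywhere.

   Interior capacity is not finitely subadditive on arbitrary sets, but here the
   exceptional sets are traces on A_i of sets {u < v + c g}, with u, v potentials
   of positive measures.  If such a set is not null for a measure tau of finite
   energy, then, u and v being continuous off open sets of small tau-measure, it
   contains a closed set F that is not tau-null, and the restriction of tau to F
   is again a measure of finite energy. *)

(** * Functions with compact support *)

(** Integrals are suprema over minorants in [Cc], on a space that need not be sigma-compact. Hence
    every exchange of integral and supremum (additivity in the integrand, Fubini for [k], monotone
    convergence) goes through Dini's theorem along an upward directed family in [Cc]. A first
    obstacle: finite energy of nu speaks of the Jordan parts of the product of nu with itself, not
    of those of nu. The domination of |nu| (x) |nu| by |nu (x) nu| bridges this: |nu|, hence both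
    parts of nu, has finite energy, and from there on only positive measures have to be handled. A
    second one: Jordan parts are not additive in nu. Integrals of signed measures are therefore
    computed from any decomposition into positive measures with finite integrals, the value being
    independent of the choice. Finally, relations holding n.e. in a set E are combined after
    translation: each becomes an almost everywhere statement for all positive measures of finite
    energy and finite mass carried by E, where finite unions of exceptional sets are harmless; the
    result is translated back. *)

Lemma compact_ind (T : topologicalType) (K : set T) (P : set T -> Prop) :
  compact K -> P set0 -> (forall A B, A `<=` B -> P B -> P A) ->
  (forall A B, P A -> P B -> P (A `|` B)) ->
  (forall x, K x -> exists2 V, nbhs x V & P V) -> P K.
Proof.
move=> cK P0 Psub PU Ploc; apply: contrapT => nPK.
(* If [P K] failed, this filter would be proper. It contains [K], by [P set0], so it clusters at
   some x in [K]; a neighbourhood V of x with [P V] puts the complement of V into the filter, a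
   contradiction. *)
pose F : set_system T := [set A | P (K `\` A)].
have FF : ProperFilter F.
  apply: Build_ProperFilter.
    by rewrite /F /= setD0.
  split.
  - by rewrite /F /= setDT.
  - by move=> A B FA FB; rewrite /F /= setDIr; exact: PU.
  - by move=> A B AB; apply: Psub => x [Kx nB]; split => // /AB.
have FK : F K by rewrite /F /= setDv.
have [x [Kx clx]] := cK F FF FK.
have [V xV PV] := Ploc x Kx.
have FV : F (~` V) by apply: Psub PV => y [_ /contrapT].
by have [y [nVy Vy]] := clx _ _ FV xV.
Qed.

Lemma hausdorff_setX (S T : topologicalType) :
  hausdorff_space S -> hausdorff_space T -> hausdorff_space (S * T)%type.
Proof.
move=> hS hT [p1 p2] [q1 q2] cl; congr pair.
- apply: hS => A B pA qB.
  have [||[x y] [[/= Ax _] [/= Bx _]]] := cl (A `*` setT) (B `*` setT).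
  + by exists (A, setT) => //; split => //; exact: filterT.
  + by exists (B, setT) => //; split => //; exact: filterT.
  by exists x.
- apply: hT => A B pA qB.
  have [||[x y] [[/= _ Ax] [/= _ Bx]]] := cl (setT `*` A) (setT `*` B).
  + by exists (setT, A) => //; split => //; exact: filterT.
  + by exists (setT, B) => //; split => //; exact: filterT.
  by exists y.
Qed.

Lemma locally_compact_setX (S T : topologicalType) :
  hausdorff_space S -> hausdorff_space T ->
  locally_compact [set: S] -> locally_compact [set: T] ->
  locally_compact [set: (S * T)%type].
Proof.
move=> hS hT lS lT [x y] _.
have [U xU [cU _]] := lS x I; have [V yV [cV _]] := lT y I.
have cUV : compact (U `*` V) by exact: compact_setX.
exists (U `*` V).
  exists (U, V).
    by split => /=; [move: xU|move: yV]; rewrite /within /=;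
      apply: filterS => z /(_ I).
  by move=> z [Uz Vz] _.
split => //; apply: compact_closed cUV; exact: hausdorff_setX.
Qed.

Section Cc.
Context {R : realType} {T : topologicalType} (hT : hausdorff_space T).
Implicit Types (f h : T -> R) (mu nu : (T -> R) -> R).

(** Compact sets are closed in a Hausdorff space, so a function vanishing off a compact set has its
    support inside it. This form spares the closure in later membership proofs. *)
Lemma CcP f : Cc R T f <->
  continuous f /\ exists2 K, compact K & forall x, ~ K x -> f x = 0.
Proof.
split=> [[cf kf]|[cf [K cK fK]]]; split => //.
  exists (closure [set x | f x != 0]) => // x nx.
  apply/eqP; apply: contrapT => /negP fx; apply: nx; exact: subset_closure.
apply: (subclosed_compact _ cK); first exact: closed_closure.
have /closure_id -> := compact_closed hT cK.
apply: closureS => x /= fx; apply: contrapT => /fK fx0.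
by rewrite fx0 eqxx in fx.
Qed.

Lemma supp_sub (K : set T) f : compact K -> (forall x, ~ K x -> f x = 0) ->
  closure [set x | f x != 0] `<=` K.
Proof.
move=> cK fK; have -> := iffLR (closure_id K) (compact_closed hT cK).
apply: closureS => x /= fx; apply: contrapT => /fK fx0.
by rewrite fx0 eqxx in fx.
Qed.

Lemma Cc_dom (h f : T -> R) : Cc R T f -> continuous h ->
  (forall x, f x = 0 -> h x = 0) -> Cc R T h.
Proof.
move=> /CcP[cf [K cK fK]] ch fh; apply/CcP; split => //.
by exists K => // x /fK/fh.
Qed.

Lemma Cc_dom2 (f g h : T -> R) : Cc R T f -> Cc R T g -> continuous h ->
  (forall x, f x = 0 -> g x = 0 -> h x = 0) -> Cc R T h.
Proof.
move=> /CcP[cf [K cK fK]] /CcP[cg [L cL gL]] ch fgh; apply/CcP; split => //.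
exists (K `|` L); first exact: compactU.
by move=> x nKL; apply: fgh; [apply: fK|apply: gL]; move=> ?; apply: nKL;
  [left|right].
Qed.

Lemma Cc0 : Cc R T (fun=> 0).
Proof.
apply/CcP; split; first exact: cst_continuous.
by exists set0 => //; exact: compact0.
Qed.

Lemma Cc_cont f : Cc R T f -> continuous f. Proof. by case. Qed.

Lemma continuousDf f h : continuous f -> continuous h ->
  continuous (fun x => f x + h x).
Proof. by move=> cf ch x; apply: cvgD; [exact: cf|exact: ch]. Qed.

Lemma continuousNf f : continuous f -> continuous (fun x => - f x).
Proof. by move=> cf x; apply: cvgN; exact: cf. Qed.

Lemma continuousMf f h : continuous f -> continuous h ->
  continuous (fun x => f x * h x).
Proof. by move=> cf ch x; apply: cvgM; [exact: cf|exact: ch]. Qed.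

Lemma continuousZf c f : continuous f -> continuous (fun x => c * f x).
Proof. by move=> cf; apply: continuousMf => //; exact: cst_continuous. Qed.

Lemma continuous_maxf f h : continuous f -> continuous h ->
  continuous (fun x => Num.max (f x) (h x)).
Proof. by move=> cf ch x; apply: continuous_max; [exact: cf|exact: ch]. Qed.

Lemma continuous_minf f h : continuous f -> continuous h ->
  continuous (fun x => Num.min (f x) (h x)).
Proof. by move=> cf ch x; apply: continuous_min; [exact: cf|exact: ch]. Qed.

Lemma CcD f h : Cc R T f -> Cc R T h -> Cc R T (fun x => f x + h x).
Proof.
move=> Cf Ch; apply: (Cc_dom2 Cf Ch); first by apply: continuousDf; exact: Cc_cont.
by move=> x -> ->; rewrite addr0.
Qed.

Lemma CcZ c f : Cc R T f -> Cc R T (fun x => c * f x).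
Proof.
move=> Cf; apply: (Cc_dom Cf); first by apply: continuousZf; exact: Cc_cont.
by move=> x ->; rewrite mulr0.
Qed.

Lemma CcN f : Cc R T f -> Cc R T (fun x => - f x).
Proof.
move=> Cf; apply: (Cc_dom Cf); first by apply: continuousNf; exact: Cc_cont.
by move=> x ->; rewrite oppr0.
Qed.

Lemma CcB f h : Cc R T f -> Cc R T h -> Cc R T (fun x => f x - h x).
Proof. by move=> Cf Ch; apply: CcD => //; exact: CcN. Qed.

Lemma CcMr f h : Cc R T f -> continuous h -> Cc R T (fun x => f x * h x).
Proof.
move=> Cf ch; apply: (Cc_dom Cf).
  by apply: continuousMf => //; exact: Cc_cont.
by move=> x ->; rewrite mul0r.
Qed.

Lemma Cc_max f h : Cc R T f -> Cc R T h -> Cc R T (fun x => Num.max (f x) (h x)).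
Proof.
move=> Cf Ch; apply: (Cc_dom2 Cf Ch); first by apply: continuous_maxf; exact: Cc_cont.
by move=> x -> ->; rewrite maxxx.
Qed.

Lemma Cc_min f h : Cc R T f -> Cc R T h -> Cc R T (fun x => Num.min (f x) (h x)).
Proof.
move=> Cf Ch; apply: (Cc_dom2 Cf Ch); first by apply: continuous_minf; exact: Cc_cont.
by move=> x -> ->; rewrite minxx.
Qed.

Lemma Cc_pos f : Cc R T f -> Cc R T f^\+.
Proof. by move=> Cf; apply: Cc_max => //; exact: Cc0. Qed.

Lemma Cc_neg f : Cc R T f -> Cc R T f^\-.
Proof. by move=> Cf; apply: Cc_max; [exact: CcN|exact: Cc0]. Qed.

Lemma Cc_bounded f : Cc R T f -> exists2 b, 0 <= b & forall x, `|f x| <= b.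
Proof.
move=> /CcP[cf [K cK fK]].
suff [b b0 fb] : exists2 b, 0 <= b & forall x, K x -> `|f x| <= b.
  exists b => // x; have [/fb//|/fK ->] := pselect (K x); by rewrite normr0.
apply: (@compact_ind T K (fun A => exists2 b, 0 <= b & forall x, A x -> `|f x| <= b)) => //.
- by exists 0.
- by move=> A B AB [b b0 H]; exists b => // x /AB/H.
- move=> A B [b b0 H] [c c0 H']; exists (b + c); first exact: addr_ge0.
  by move=> x [/H|/H']; lra.
- move=> x Kx; exists [set y | `|f y| <= `|f x| + 1]; last first.
    by exists (`|f x| + 1) => //; rewrite addr_ge0.
  have := cf x; move=> /cvgrPdist_le/(_ 1 ltr01); apply: filterS => y h /=.
  have := ler_normD (f y - f x) (f x); rewrite subrK distrC => h'.
  by apply: (le_trans h'); rewrite addrC lerD2l.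
Qed.

Hypothesis lT : locally_compact [set: T].

(** Complete regularity separates x from the complement of the interior of V intersected with a
    compact neighbourhood of x. The separating function is 0 at x and 1 on that closed set, so its
    difference to 1 is the bump. *)
Lemma Cc_bump (x : T) (V : set T) : nbhs x V ->
  exists f, [/\ Cc R T f, forall y, 0 <= f y <= 1, f x = 1 &
               forall y, ~ V y -> f y = 0].
Proof.
move=> xV.
have [K xK [cK clK]] := @lT x I.
have {}xK : nbhs x K by move: xK; rewrite /within /=; apply: filterS => z /(_ I).
pose W := interior (V `&` K).
have Wx : W x by rewrite /W; apply: filterI.
have WVK : W `<=` V `&` K by exact: interior_subset.
have clW : closed (~` W) by apply: open_closedC; exact: open_interior.
have nW : ~ (~` W) x by move=> /(_ Wx).
have /(@uniform_separatorP _ R)[f [cf f01 fx0 fW1]] :=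
  @locally_compact_completely_regular T R lT hT x (~` W) clW nW.
have f_in y : 0 <= f y <= 1.
  by have := f01 (f y) (ex_intro2 _ _ y I erefl); rewrite /= in_itv.
have fo y : ~ W y -> 1 - f y = 0.
  by move=> nWy; have /= -> := fW1 (f y) (ex_intro2 _ _ y nWy erefl); rewrite subrr.
exists (fun y => 1 - f y); split.
- apply/CcP; split.
    by apply: continuousDf; [exact: cst_continuous|exact: continuousNf].
  by exists K => // y nK; apply: fo => /WVK[].
- by move=> y; have /andP[? ?] := f_in y; apply/andP; split; lra.
- by have /= -> := fx0 (f x) (ex_intro2 _ _ x erefl erefl); rewrite subr0.
- by move=> y nV; apply: fo => /WVK[].
Qed.

Lemma nbhs_gt f x c : continuous f -> c < f x -> nbhs x [set y | c < f y].
Proof.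
move=> cf cx; have e0 : 0 < f x - c by rewrite subr_gt0.
have := cf x; move=> /cvgrPdist_lt/(_ _ e0); apply: filterS => y /=.
by rewrite ltr_distlC => /andP[h _]; move: h; rewrite opprB addrC subrK.
Qed.

(** A sum of doubled bumps, each at least 1 where its bump exceeds 1/2. Asking for no upper bound
    keeps the property stable under sums. *)
Lemma Cc_ge1 (K : set T) : compact K ->
  exists f, [/\ Cc R T f, forall y, 0 <= f y & forall y, K y -> 1 <= f y].
Proof.
move=> cK; apply: (@compact_ind T K (fun K => exists f, [/\ Cc R T f,
  forall y, 0 <= f y & forall y, K y -> 1 <= f y])) => //.
- by exists (fun=> 0); split => //; exact: Cc0.
- by move=> A B AB [f [? ? h]]; exists f; split => // y /AB/h.
- move=> A B [f [Cf f0 fA]] [h [Ch h0 hB]]; exists (fun x => f x + h x).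
  split; [exact: CcD|by move=> y; rewrite addr_ge0|].
  move=> y [/fA|/hB]; [have := h0 y|have := f0 y]; lra.
- move=> x Kx; have [f [Cf f01 fx _]] := Cc_bump (@filterT _ (nbhs x) _).
  exists [set y | 2^-1 < f y].
    by apply: nbhs_gt; [exact: Cc_cont|rewrite fx; lra].
  exists (fun x => 2 * f x); split; first exact: CcZ.
    by move=> y; have /andP[? _] := f01 y; lra.
  by move=> y /=; lra.
Qed.

End Cc.

(** * Radon measures and their Jordan decomposition *)

Section radon_measures.
Context {R : realType} {T : topologicalType} (hT : hausdorff_space T).
Implicit Types (f h : T -> R) (mu nu : (T -> R) -> R).

Lemma radon_out nu f : radon R T nu -> ~ Cc R T f -> nu f = 0.
Proof. by case=> h _ _; exact: h. Qed.

Lemma radon_lin nu c f h : radon R T nu -> Cc R T f -> Cc R T h ->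
  nu (fun x => c * f x + h x) = c * nu f + nu h.
Proof. by case=> _ h' _; exact: h'. Qed.

Lemma radonD nu f h : radon R T nu -> Cc R T f -> Cc R T h ->
  nu (fun x => f x + h x) = nu f + nu h.
Proof.
move=> rnu Cf Ch; rewrite -[nu f]mul1r -radon_lin //.
by congr nu; apply/funext => x; rewrite mul1r.
Qed.

Lemma radon0 nu : radon R T nu -> nu (fun=> 0) = 0.
Proof.
move=> rnu; have := radonD rnu (Cc0 hT) (Cc0 hT).
rewrite (_ : (fun x : T => 0 + 0) = fun=> 0); first by lra.
by apply/funext => x; rewrite addr0.
Qed.

Lemma radonZ nu c f : radon R T nu -> Cc R T f ->
  nu (fun x => c * f x) = c * nu f.
Proof.
move=> rnu Cf; rewrite -[RHS]addr0 -(radon0 rnu) -radon_lin //; last exact: Cc0.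
by congr nu; apply/funext => x; rewrite addr0.
Qed.

Lemma radonN nu f : radon R T nu -> Cc R T f -> nu (fun x => - f x) = - nu f.
Proof.
move=> rnu Cf; rewrite -mulN1r -radonZ //.
by congr nu; apply/funext => x; rewrite mulN1r.
Qed.

Lemma radonB nu f h : radon R T nu -> Cc R T f -> Cc R T h ->
  nu (fun x => f x - h x) = nu f - nu h.
Proof.
by move=> rnu Cf Ch; rewrite radonD //; [rewrite radonN|exact: CcN].
Qed.

Lemma radon_combo s t nu mu : radon R T nu -> radon R T mu ->
  radon R T (fun f => s * nu f + t * mu f).
Proof.
move=> rnu rmu; split.
- by move=> f nf; rewrite !radon_out // !mulr0 addr0.
- by move=> c f h Cf Ch; rewrite !radon_lin //; lra.
- move=> K cK; have [_ _ /(_ K cK)[M1 h1]] := rnu.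
  have [_ _ /(_ K cK)[M2 h2]] := rmu.
  exists (`|s| * M1 + `|t| * M2) => f b Cf sf fb.
  apply: (le_trans (ler_normD _ _)); rewrite !normrM mulrDl -!mulrA lerD //.
    by apply: ler_wpM2l => //; exact: h1.
  by apply: ler_wpM2l => //; exact: h2.
Qed.

Lemma radon_add nu mu : radon R T nu -> radon R T mu -> radon R T (nu \+ mu).
Proof.
move=> rnu rmu; have := radon_combo 1 1 rnu rmu.
by congr radon; apply/funext => f /=; rewrite !mul1r.
Qed.

Lemma radon_sub nu mu : radon R T nu -> radon R T mu -> radon R T (nu \- mu).
Proof.
move=> rnu rmu; have := radon_combo 1 (-1) rnu rmu.
by congr radon; apply/funext => f /=; rewrite mul1r mulN1r.
Qed.

Lemma radon_opp nu : radon R T nu -> radon R T (\- nu).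
Proof.
move=> rnu; have := radon_combo (-1) 0 rnu rnu.
by congr radon; apply/funext => f /=; rewrite mul0r addr0 mulN1r.
Qed.

Lemma posnegE f x : f^\+ x - f^\- x = f x.
Proof. exact: (congr1 (fun u => u x) (funrposBneg f)). Qed.

Lemma radon_ext nu mu : radon R T nu -> radon R T mu ->
  (forall f, Cc R T f -> (forall x, 0 <= f x) -> nu f = mu f) -> nu = mu.
Proof.
move=> rnu rmu e; apply/funext => f.
have [Cf|nf] := pselect (Cc R T f); last by rewrite !radon_out.
have -> : f = (fun x => f^\+ x - f^\- x).
  by apply/funext => x; rewrite posnegE.
have Cp := Cc_pos hT Cf; have Cn := Cc_neg hT Cf.
by rewrite !radonB // !e.
Qed.

Lemma pos_radon mu : radon_pos R T mu -> radon R T mu. Proof. by case. Qed.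

Lemma pos_ge0 mu f : radon_pos R T mu -> (forall x, 0 <= f x) -> 0 <= mu f.
Proof.
move=> pmu f0; have [Cf|nf] := pselect (Cc R T f).
  by case: pmu => _; exact.
by rewrite radon_out //; exact: pos_radon.
Qed.

Lemma pos_le mu f h : radon_pos R T mu -> Cc R T f -> Cc R T h ->
  (forall x, f x <= h x) -> mu f <= mu h.
Proof.
move=> pmu Cf Ch fh; rewrite -subr_ge0 -radonB //; last exact: pos_radon.
by apply: pos_ge0 => // x; rewrite subr_ge0.
Qed.

Lemma pos_add nu mu : radon_pos R T nu -> radon_pos R T mu ->
  radon_pos R T (nu \+ mu).
Proof.
move=> pnu pmu; split; first by apply: radon_add; exact: pos_radon.
by move=> f Cf f0 /=; rewrite addr_ge0 // pos_ge0.
Qed.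

Lemma pos_scale c mu : 0 <= c -> radon_pos R T mu ->
  radon_pos R T (fun f => c * mu f).
Proof.
move=> c0 pmu; split.
  have := radon_combo c 0 (pos_radon pmu) (pos_radon pmu).
  by congr radon; apply/funext => f; rewrite mul0r addr0.
by move=> f Cf f0; rewrite mulr_ge0 // pos_ge0.
Qed.

Lemma radon_bound mu K : radon R T mu -> compact K ->
  exists2 M, 0 <= M & forall f b, Cc R T f -> (forall x, ~ K x -> f x = 0) ->
    0 <= b -> (forall x, `|f x| <= b) -> `|mu f| <= M * b.
Proof.
move=> [_ _ H] /[dup] cK /H[M HM]; exists `|M| => // f b Cf fK b0 fb.
apply: (@le_trans _ _ (M * b)); last by apply: ler_wpM2r => //; exact: ler_norm.
by apply: HM => //; exact: supp_sub.
Qed.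

Hypothesis lT : locally_compact [set: T].

(** Positivity implies continuity: with [w] at least 1 on K, a function supported in K and bounded
    by b lies between [- b * w] and [b * w], so [mu w] serves as the constant for K. *)
Lemma radon_posI mu : (forall f, ~ Cc R T f -> mu f = 0) ->
  (forall c f h, Cc R T f -> Cc R T h ->
     mu (fun x => c * f x + h x) = c * mu f + mu h) ->
  (forall f, Cc R T f -> (forall x, 0 <= f x) -> 0 <= mu f) ->
  radon_pos R T mu.
Proof.
move=> mu0 mulin mupos; split => //; split => //.
move=> K cK; have [w [Cw w0 w1]] := @Cc_ge1 R T hT lT K cK.
have muge f b : Cc R T f -> (forall x, f x <= b * w x) -> mu f <= mu w * b.
  move=> Cf fb.
  have C1 : Cc R T (fun x => (-1) * f x + 0) by apply: (CcD hT); [exact: CcZ|exact: Cc0].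
  have mz : mu (fun=> 0) = 0.
    have := mulin 1 _ _ (Cc0 hT) (Cc0 hT).
    rewrite (_ : (fun x : T => 1 * 0 + 0) = fun=> 0); first by lra.
    by apply/funext => x; rewrite mulr0 addr0.
  have h0 : 0 <= mu (fun x => b * w x + ((-1) * f x + 0)).
    apply: mupos; first by apply: CcD => //; exact: CcZ.
    by move=> x; have := fb x; lra.
  by move: h0; rewrite !mulin //; [rewrite mz; lra|exact: Cc0].
exists (mu w) => f b Cf sf fb.
have fbw x : `|f x| <= b * w x.
  have b0 : 0 <= b by apply: le_trans (fb x).
  have [fx0|fx0] := eqVneq (f x) 0.
    by rewrite fx0 normr0 mulr_ge0.
  apply: (le_trans (fb x)); rewrite -{1}[b]mulr1; apply: ler_wpM2l => //.
  by apply: w1; apply: sf; exact: subset_closure.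
rewrite ler_norml; apply/andP; split; last first.
  by apply: muge => // x; apply: le_trans (fbw x); exact: ler_norm.
have : mu (fun x => - f x) <= mu w * b.
  by apply: muge; [exact: CcN|move=> x; apply: le_trans (fbw x); rewrite -normrN ler_norm].
have -> : mu (fun x => - f x) = - mu f; last by lra.
have := mulin (-1) f (fun x => - f x) Cf (CcN hT Cf).
have := mulin 1 _ _ (Cc0 hT) (Cc0 hT).
rewrite (_ : (fun x : T => 1 * 0 + 0) = fun=> 0); last first.
  by apply/funext => x; rewrite mulr0 addr0.
have := mulin (-1) f (fun=> 0) Cf (Cc0 hT).
rewrite (_ : (fun x : T => -1 * f x + 0) = fun x => - f x); first by lra.
by apply/funext => x; rewrite addr0 mulN1r.
Qed.

(** * Extension of a functional from the nonnegative cone to all of [Cc] *)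

Section cone_extension.
Variable J : (T -> R) -> R.
Hypothesis JD : forall f h, Cc R T f -> Cc R T h ->
  (forall x, 0 <= f x) -> (forall x, 0 <= h x) ->
  J (fun x => f x + h x) = J f + J h.
Hypothesis JZ : forall c f, 0 <= c -> Cc R T f -> (forall x, 0 <= f x) ->
  J (fun x => c * f x) = c * J f.
Hypothesis J0 : forall f, Cc R T f -> (forall x, 0 <= f x) -> 0 <= J f.

Let L := on_Cc (fun f => J f^\+ - J f^\-).

(** Since [f^\+ + q = f^\- + p], additivity of [J] on the cone shows that the value does not depend
    on the decomposition. Linearity of the extension then needs only some decomposition of the
    combination. *)
Lemma ext_split f p q : Cc R T p -> Cc R T q -> (forall x, 0 <= p x) ->
  (forall x, 0 <= q x) -> f = (fun x => p x - q x) -> L f = J p - J q.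
Proof.
move=> Cp Cq p0 q0 fE; have Cf : Cc R T f by rewrite fE; exact: CcB.
have f0 : forall x, 0 <= f^\+ x by exact: funrpos_ge0.
have f0' : forall x, 0 <= f^\- x by exact: funrneg_ge0.
have := JD (Cc_pos hT Cf) Cq f0 q0; have := JD (Cc_neg hT Cf) Cp f0' p0.
rewrite /L /on_Cc; case: asboolP => // _.
rewrite (_ : (fun x => f^\+ x + q x) = (fun x => f^\- x + p x)); first by lra.
by apply/funext => x; have := posnegE f x; rewrite {3}fE; lra.
Qed.

Lemma cone_ext_pos : radon_pos R T L.
Proof.
have pf f x : 0 <= f^\+ x :> R by exact: funrpos_ge0.
have nf f x : 0 <= f^\- x :> R by exact: funrneg_ge0.
have LE f : Cc R T f -> L f = J f^\+ - J f^\-.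
  by move=> Cf; rewrite /L /on_Cc; case: asboolP.
apply: radon_posI.
- by move=> f nCf; rewrite /L /on_Cc; case: asboolP.
- move=> c f h Cf Ch; have [c0|c0] := leP 0 c.
    rewrite (LE f) // (LE h) //.
    rewrite (@ext_split _ (fun x => c * f^\+ x + h^\+ x) (fun x => c * f^\- x + h^\- x)).
    + rewrite !JD //; try (by apply: CcZ => //; first [exact: Cc_pos|exact: Cc_neg]);
        try (by first [exact: Cc_pos|exact: Cc_neg]);
        try (by move=> x; apply: mulr_ge0).
      rewrite !JZ //; [lra|exact: Cc_neg|exact: Cc_pos].
    + by apply: CcD => //; [apply: CcZ => //|]; exact: Cc_pos.
    + by apply: CcD => //; [apply: CcZ => //|]; exact: Cc_neg.
    + by move=> x; rewrite addr_ge0 ?mulr_ge0.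
    + by move=> x; rewrite addr_ge0 ?mulr_ge0.
    + apply/funext => x; rewrite -(posnegE f x) -(posnegE h x); lra.
  (* A negative factor exchanges the two parts of f. *)
  have c0' : 0 <= - c by lra.
  rewrite (LE f) // (LE h) //.
  rewrite (@ext_split _ (fun x => (- c) * f^\- x + h^\+ x)
                        (fun x => (- c) * f^\+ x + h^\- x)).
  + rewrite !JD //; try (by apply: CcZ => //; first [exact: Cc_pos|exact: Cc_neg]);
      try (by first [exact: Cc_pos|exact: Cc_neg]);
      try (by move=> x; apply: mulr_ge0).
    rewrite !JZ //; [lra|exact: Cc_pos|exact: Cc_neg].
  + by apply: CcD => //; [apply: CcZ => //; exact: Cc_neg|exact: Cc_pos].
  + by apply: CcD => //; [apply: CcZ => //; exact: Cc_pos|exact: Cc_neg].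
  + by move=> x; rewrite addr_ge0 ?mulr_ge0.
  + by move=> x; rewrite addr_ge0 ?mulr_ge0.
  + apply/funext => x; rewrite -(posnegE f x) -(posnegE h x); lra.
- move=> f Cf f0; rewrite (@ext_split f f (fun=> 0)) //; [|exact: Cc0|].
    have := JZ (lexx 0) Cf f0; rewrite mul0r (_ : (fun x => 0 * f x) = fun=> 0).
      by move=> ->; rewrite subr0; exact: J0.
    by apply/funext => x; rewrite mul0r.
  by apply/funext => x; rewrite subr0.
Qed.

Lemma cone_extE f : Cc R T f -> (forall x, 0 <= f x) -> L f = J f.
Proof.
move=> Cf f0; rewrite (@ext_split f f (fun=> 0)) //; [|exact: Cc0|].
  have := JZ (lexx 0) Cf f0; rewrite mul0r (_ : (fun x => 0 * f x) = fun=> 0).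
    by move=> ->; rewrite subr0.
  by apply/funext => x; rewrite mul0r.
by apply/funext => x; rewrite subr0.
Qed.

End cone_extension.

(** * The positive and negative parts of a Radon measure *)

Section jordan.
Variable nu : (T -> R) -> R.
Hypothesis rnu : radon R T nu.

Lemma jsup_has_sup f : Cc R T f -> (forall x, 0 <= f x) ->
  has_sup [set nu h | h in [set h | Cc R T h /\ forall x, 0 <= h x <= f x]].
Proof.
move=> Cf f0; split.
  exists (nu (fun=> 0)), (fun=> 0) => //; split; first exact: Cc0.
  by move=> x; rewrite lexx f0.
have [b b0 fb] := Cc_bounded hT Cf.
have [cf [K cK fK]] := iffLR (CcP hT f) Cf.
have [_ _ /(_ K cK)[M HM]] := rnu.
exists (M * b) => _ [h [Ch hf] <-].
apply: (le_trans (ler_norm _)); apply: HM => //.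
  apply: supp_sub => // x nKx; have := hf x; rewrite (fK x nKx) => hx.
  by apply/eqP; rewrite eq_le andbC.
move=> x; have /andP[h0 h1] := hf x; rewrite ger0_norm //.
by apply: (le_trans h1); apply: le_trans (fb x); exact: ler_norm.
Qed.

Lemma jsup_ub f h : Cc R T f -> Cc R T h -> (forall x, 0 <= h x <= f x) ->
  nu h <= jsup nu f.
Proof.
move=> Cf Ch hf; apply: sup_ubound; last by exists h.
apply: (jsup_has_sup Cf _).2 => x.
by have /andP[a b] := hf x; exact: le_trans a b.
Qed.

Lemma jsup_le f c : Cc R T f -> (forall x, 0 <= f x) ->
  (forall h, Cc R T h -> (forall x, 0 <= h x <= f x) -> nu h <= c) ->
  jsup nu f <= c.
Proof.
move=> Cf f0 H; apply: sup_le_ub; first exact: (jsup_has_sup Cf f0).1.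
by move=> _ [h [Ch hf] <-]; exact: H.
Qed.

Lemma jsup_ge0 f : Cc R T f -> (forall x, 0 <= f x) -> 0 <= jsup nu f.
Proof.
move=> Cf f0; rewrite -(radon0 rnu); apply: jsup_ub => //; first exact: Cc0.
by move=> x; rewrite lexx f0.
Qed.

(** Riesz decomposition: a function w between 0 and [f + h] is the sum of [min(w, f)], which lies
    below f, and of the remainder, which lies below h. *)
Lemma jsupD f h : Cc R T f -> Cc R T h ->
  (forall x, 0 <= f x) -> (forall x, 0 <= h x) ->
  jsup nu (fun x => f x + h x) = jsup nu f + jsup nu h.
Proof.
move=> Cf Ch f0 h0; have Cfh := CcD hT Cf Ch.
apply/eqP; rewrite eq_le; apply/andP; split.
  apply: jsup_le => //; first by move=> x; rewrite addr_ge0.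
  move=> w Cw wfh; have Cm := Cc_min hT Cw Cf.
  have Cd := CcB hT Cw Cm.
  rewrite (_ : nu w = nu (fun x => Num.min (w x) (f x)) +
                      nu (fun x => w x - Num.min (w x) (f x))); last first.
    by rewrite -radonD //; congr nu; apply/funext => x; rewrite addrC subrK.
  apply: lerD; apply: jsup_ub => // x; have /andP[] := wfh x; have := f0 x;
    have := h0 x; rewrite /Order.min; case: ifP => [|/negbT]; rewrite -?leNgt => *;
    apply/andP; split; lra.
rewrite -lerBrDr; apply: jsup_le => // w Cw wf.
rewrite lerBrDr -lerBrDl; apply: jsup_le => // v Cv vh.
rewrite lerBrDl -radonD //; apply: jsup_ub => //; first exact: CcD.
by move=> x; have /andP[? ?] := wf x; have /andP[? ?] := vh x; apply/andP; split; lra.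
Qed.

Lemma jsupZ_le c f : 0 < c -> Cc R T f -> (forall x, 0 <= f x) ->
  jsup nu (fun x => c * f x) <= c * jsup nu f.
Proof.
move=> c0 Cf f0; apply: jsup_le; [exact: CcZ|by move=> x; rewrite mulr_ge0 // ltW|].
move=> w Cw wf; rewrite -ler_pdivrMl // -radonZ //; apply: jsup_ub => //.
  exact: CcZ.
move=> x; have /andP[w0 w1] := wf x.
by rewrite ler_pdivrMl // w1 andbT mulr_ge0 // invr_ge0 ltW.
Qed.

Lemma jsupZ c f : 0 <= c -> Cc R T f -> (forall x, 0 <= f x) ->
  jsup nu (fun x => c * f x) = c * jsup nu f.
Proof.
rewrite le_eqVlt => /predU1P[<-|c0] Cf f0.
  apply/eqP; rewrite mul0r eq_le jsup_ge0 ?andbT; [|exact: CcZ|by move=> x; rewrite mul0r].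
  apply: jsup_le; [exact: CcZ|by move=> x; rewrite mul0r|].
  move=> h Ch hf; rewrite (_ : h = fun=> 0) ?radon0 //; apply/funext => x.
  by apply/eqP; rewrite eq_le andbC; have := hf x; rewrite mul0r.
apply/eqP; rewrite eq_le jsupZ_le //=.
rewrite -ler_pdivlMl //; apply: le_trans (jsupZ_le _ _ _).
- rewrite (_ : (fun x => c^-1 * (c * f x)) = f) //.
  by apply/funext => x; rewrite mulKf // gt_eqF.
- by rewrite invr_gt0.
- exact: CcZ.
- by move=> x; rewrite mulr_ge0 // ltW.
Qed.

Lemma jpos_pos : radon_pos R T (jpos nu).
Proof. by apply: cone_ext_pos; [exact: jsupD|exact: jsupZ|exact: jsup_ge0]. Qed.

Lemma jposE f : Cc R T f -> (forall x, 0 <= f x) -> jpos nu f = jsup nu f.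
Proof. by apply: cone_extE; [exact: jsupD|exact: jsupZ]. Qed.

End jordan.

Lemma jneg_pos nu : radon R T nu -> radon_pos R T (jneg nu).
Proof. by move=> rnu; apply: jpos_pos; exact: radon_opp. Qed.

(** The reflection sending h to f - h preserves the interval from 0 to f, so that [jsup nu f - nu f]
    is the supremum belonging to the opposite functional. *)
Lemma jordanE nu : radon R T nu -> nu = jpos nu \- jneg nu.
Proof.
move=> rnu; have rnu' := radon_opp rnu.
apply: radon_ext => //.
  by apply: radon_sub; apply: pos_radon; [exact: jpos_pos|exact: jneg_pos].
move=> f Cf f0 /=; rewrite /jneg !jposE //.
have h1 : jsup (\- nu) f <= jsup nu f - nu f.
  apply: jsup_le => // h Ch hf /=; rewrite lerBrDr addrC -radonB //.
  by apply: jsup_ub => //; [exact: CcB|move=> x; have := hf x; lra].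
have h2 : jsup nu f <= jsup (\- nu) f + nu f.
  apply: jsup_le => // h Ch hf; rewrite -lerBlDr.
  rewrite -[leLHS]opprB -radonB //.
  by apply: (@jsup_ub (\- nu)) => //; [exact: CcB|move=> x; have := hf x; lra].
by lra.
Qed.

(** For h between 0 and f, [nu h <= P h <= P f]. This minimality lets any decomposition be compared
    with the Jordan one. *)
Lemma jordan_min nu P N : radon R T nu -> radon_pos R T P -> radon_pos R T N ->
  nu = P \- N -> radon_pos R T (P \- jpos nu).
Proof.
move=> rnu pP pN nuE; split.
  by apply: radon_sub; apply: pos_radon => //; exact: jpos_pos.
move=> f Cf f0 /=; rewrite subr_ge0 jposE //; apply: jsup_le => // h Ch hf.
rewrite nuE /=; have : P h <= P f by apply: pos_le => // x; have /andP[] := hf x.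
have : 0 <= N h by apply: pos_ge0 => // x; have /andP[] := hf x.
by lra.
Qed.

Lemma abs_ub nu f a : radon R T nu -> Cc R T f -> Cc R T a ->
  (forall x, `|a x| <= f x) -> nu a <= (jpos nu \+ jneg nu) f.
Proof.
move=> rnu Cf Ca af; rewrite {1}(jordanE rnu) /=.
have pj := jpos_pos rnu; have pn := jneg_pos rnu.
have Cn := CcN hT Ca.
have h1 : jpos nu a <= jpos nu f.
  by apply: pos_le => // x; apply: le_trans (af x); exact: ler_norm.
have h2 : jneg nu (fun x => - a x) <= jneg nu f.
  by apply: pos_le => // x; apply: le_trans (af x); rewrite -normrN ler_norm.
by move: h2; rewrite (radonN (pos_radon pn)) //; lra.
Qed.

(** Sending h to 2h - f maps the interval from 0 to f into the functions of absolute value at most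
    f, and [jpos nu f + jneg nu f = 2 * jpos nu f - nu f]. Together with [abs_ub] this identifies
    the sum of the parts as the total variation. *)
Lemma abs_le nu f c : radon R T nu -> Cc R T f -> (forall x, 0 <= f x) ->
  (forall a, Cc R T a -> (forall x, `|a x| <= f x) -> nu a <= c) ->
  (jpos nu \+ jneg nu) f <= c.
Proof.
move=> rnu Cf f0 H /=.
have E : nu f = jpos nu f - jneg nu f by rewrite {1}(jordanE rnu).
suff : jpos nu f <= (c + nu f) / 2 by lra.
rewrite (jposE rnu Cf f0); apply: (jsup_le rnu Cf f0) => h Ch hf.
suff : nu (fun x => 2 * h x - f x) <= c.
  by rewrite (radonB rnu) ?(radonZ _ rnu) //; [lra|exact: CcZ].
apply: H; first by apply: (CcB hT) => //; exact: CcZ.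
by move=> x; have /andP[? ?] := hf x; rewrite ler_norml; apply/andP; split; lra.
Qed.

End radon_measures.

(** * The integral of lower semicontinuous functions *)

Section ereal_facts.
Context {R : realType}.
Implicit Types (a b c : \bar R).
Local Open Scope ereal_scope.

Lemma lee_approx a c : (forall r, r%:E < a -> r%:E <= c) -> a <= c.
Proof.
case: a => [a||] H; last exact: leNye.
- apply/lee_subgt0Pr => e e0; rewrite -EFinB; apply: H; rewrite lte_fin; lra.
- case: c H => [c||] H //.
    by have := H (c + 1)%R (ltry _); rewrite lee_fin => ?; exfalso; lra.
  by have := H 0%R (ltry _).
Qed.

Lemma lee_add_approx a b c : -oo < a -> -oo < b ->
  (forall r s, r%:E < a -> s%:E < b -> (r + s)%:E <= c) -> a + b <= c.
Proof.
move=> a0 b0 H; apply: lee_approx => r rab.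
case: a b a0 b0 H rab => [a||] [b||] //= _ _ H rab.
- have ab : (r < a + b)%R by rewrite -lte_fin.
  have -> : r%:E = ((a - (a + b - r) / 2) + (b - (a + b - r) / 2))%:E.
    by congr EFin; lra.
  by apply: H; rewrite lte_fin; lra.
- have -> : r%:E = ((a - 1) + (r - a + 1))%:E by congr EFin; lra.
  by apply: H; rewrite ?ltry // lte_fin; lra.
- have -> : r%:E = ((r - b + 1) + (b - 1))%:E by congr EFin; lra.
  by apply: H; rewrite ?ltry // lte_fin; lra.
- have -> : r%:E = (r + 0)%:E by congr EFin; lra.
  by apply: H; rewrite ?ltry.
Qed.

Lemma lte_add_split a b (r : R) : -oo < a -> -oo < b -> r%:E < a + b ->
  exists s t, [/\ s%:E < a, t%:E < b & (r <= s + t)%R].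
Proof.
move=> a0 b0 rab; apply: contrapT => H.
have : a + b <= r%:E.
  apply: lee_add_approx => // s t sa tb; rewrite lee_fin leNgt; apply/negP => rst.
  by apply: H; exists s, t; split => //; exact: ltW.
by rewrite leNgt rab.
Qed.

End ereal_facts.

Section lsc_integral.
Context {R : realType} {T : topologicalType} (hT : hausdorff_space T).
Implicit Types (f h : T -> R) (F H : T -> \bar R) (mu nu : (T -> R) -> R).

(** Covers both nonnegative integrands and integrands bounded below on a compact space. It keeps
    integrals against positive measures above -oo, so that their sums are never of the form +oo -
    oo. *)
Definition minorized F := exists2 f, Cc R T f & forall x, ((f x)%:E <= F x)%E.

Lemma minorized_gt F x : minorized F -> (-oo < F x)%E.
Proof. by move=> [f _ fF]; apply: lt_le_trans (fF x); exact: ltNyr. Qed.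

Lemma minorized_ge0 F : (forall x, 0 <= F x)%E -> minorized F.
Proof. by move=> F0; exists (fun=> 0) => //; exact: Cc0. Qed.

Lemma le_lsc_integral mu F f : Cc R T f -> (forall x, ((f x)%:E <= F x)%E) ->
  ((mu f)%:E <= lsc_integral mu F)%E.
Proof. by move=> Cf fF; apply: ereal_sup_ubound; exists f. Qed.

Lemma lsc_integral_le mu F c :
  (forall f, Cc R T f -> (forall x, ((f x)%:E <= F x)%E) -> ((mu f)%:E <= c)%E) ->
  (lsc_integral mu F <= c)%E.
Proof. by move=> h; apply: ge_ereal_sup => _ [f [Cf fF] <-]; exact: h. Qed.

Lemma lsc_integral_mono mu F H : (forall x, F x <= H x)%E ->
  (lsc_integral mu F <= lsc_integral mu H)%E.
Proof.
move=> FH; apply: lsc_integral_le => f Cf fF; apply: le_lsc_integral => // x.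
exact: le_trans (fF x) (FH x).
Qed.

Lemma lt_lsc_integral mu F r : (r%:E < lsc_integral mu F)%E ->
  exists f, [/\ Cc R T f, forall x, ((f x)%:E <= F x)%E & r < mu f].
Proof.
by move=> /ereal_sup_gt[_ [f [Cf fF] <-]] rf; exists f; split => //; rewrite -lte_fin.
Qed.

Lemma lsc_integral_gt mu F : minorized F -> (-oo < lsc_integral mu F)%E.
Proof.
by move=> [f Cf fF]; apply: lt_le_trans (le_lsc_integral mu Cf fF); exact: ltNyr.
Qed.

Lemma lsc_integral_ge0 mu F : radon_pos R T mu -> (forall x, 0 <= F x)%E ->
  (0 <= lsc_integral mu F)%E.
Proof.
move=> pmu F0; have -> : 0%E = (mu (fun=> 0))%:E.
  by rewrite (radon0 hT (pos_radon pmu)).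
by apply: le_lsc_integral => //; exact: Cc0.
Qed.

(** The maximum of a nearly optimal minorant for [mu] and one for [nu] is nearly optimal for
    both. *)
Lemma lsc_integralD mu nu F : radon_pos R T mu -> radon_pos R T nu ->
  minorized F ->
  lsc_integral (mu \+ nu) F = (lsc_integral mu F + lsc_integral nu F)%E.
Proof.
move=> pmu pnu mF; apply/eqP; rewrite eq_le; apply/andP; split.
  apply: lsc_integral_le => f Cf fF; rewrite EFinD.
  by apply: leeD; exact: le_lsc_integral.
apply: lee_add_approx; try exact: lsc_integral_gt.
move=> r s /lt_lsc_integral[f [Cf fF rf]] /lt_lsc_integral[h [Ch hF sh]].
have Cm := Cc_max hT Cf Ch.
apply: (@le_trans _ _ ((mu \+ nu) (fun x => Num.max (f x) (h x)))%:E); last first.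
  by apply: le_lsc_integral => // x; rewrite EFin_max ge_max fF hF.
rewrite lee_fin /=; apply: lerD; apply: le_trans; try exact: ltW rf;
  try exact: ltW sh; by apply: (pos_le hT) => // x; rewrite le_max lexx ?orbT.
Qed.

Lemma lsc_integral_le_measure mu nu F : radon_pos R T mu ->
  radon_pos R T nu -> radon_pos R T (nu \- mu) -> minorized F ->
  lsc_integral nu F = (lsc_integral mu F + lsc_integral (nu \- mu)%R F)%E.
Proof.
move=> pmu pnu pd mF; rewrite -lsc_integralD //; congr lsc_integral.
by apply/funext => f /=; lra.
Qed.

Lemma lsc_integral_dom_fin mu nu F : radon_pos R T mu ->
  radon_pos R T nu -> radon_pos R T (nu \- mu) -> minorized F ->
  (lsc_integral nu F < +oo)%E -> (lsc_integral mu F < +oo)%E.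
Proof.
move=> pmu pnu pd mF; rewrite (lsc_integral_le_measure pmu pnu pd mF).
have := lsc_integral_gt mu mF; have := lsc_integral_gt (nu \- mu) mF.
by case: lsc_integral => [a||] //; case: lsc_integral => [b||].
Qed.

Lemma lsc_integralZ mu c F a : 0 <= c -> radon_pos R T mu -> minorized F ->
  lsc_integral mu F = a%:E ->
  lsc_integral (fun f => c * mu f) F = (c * a)%:E.
Proof.
move=> c0 pmu mF Fa; apply/eqP; rewrite eq_le; apply/andP; split.
  apply: lsc_integral_le => f Cf fF; rewrite lee_fin ler_wpM2l // -lee_fin -Fa.
  exact: le_lsc_integral.
have [->|cn0] := eqVneq c 0.
  case: mF => f Cf fF; rewrite mul0r.
  have := le_lsc_integral (fun f => 0 * mu f) Cf fF.
  by rewrite mul0r.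
have {}c0 : 0 < c by rewrite lt_neqAle eq_sym cn0.
apply: lee_approx => r; rewrite lte_fin -ltr_pdivrMl // -lte_fin -Fa.
move=> /lt_lsc_integral[f [Cf fF]]; rewrite ltr_pdivrMl // => /ltW rf.
by apply: le_trans (le_lsc_integral (fun f => c * mu f) Cf fF); rewrite lee_fin.
Qed.

Section split.
Hypothesis lT : locally_compact [set: T].

(** By minimality, P and N exceed the Jordan parts of nu by one and the same positive measure. Its
    integral is finite, being dominated by that of P, and cancels in the difference. *)
Lemma signed_integral_split nu P N F : radon R T nu -> radon_pos R T P ->
  radon_pos R T N -> nu = P \- N -> minorized F ->
  (lsc_integral P F < +oo)%E ->
  integral_def nu F /\
  signed_integral nu F = (lsc_integral P F - lsc_integral N F)%E.
Proof.
move=> rnu pP pN nuE mF Pfin.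
have pj := jpos_pos hT lT rnu; have nj := jneg_pos hT lT rnu.
have pd := jordan_min hT lT rnu pP pN nuE.
have pd' : P \- jpos nu = N \- jneg nu.
  apply/funext => f /=; have := congr1 (fun u => u f) nuE.
  by rewrite {1}(jordanE hT lT rnu) /=; lra.
have EP := lsc_integral_le_measure pj pP pd mF.
have EN : lsc_integral N F =
    (lsc_integral (jneg nu) F + lsc_integral (P \- jpos nu)%R F)%E.
  by rewrite pd'; apply: lsc_integral_le_measure => //; rewrite -pd'.
rewrite /integral_def /signed_integral EN EP; move: Pfin; rewrite EP.
have := lsc_integral_gt (jpos nu) mF; have := lsc_integral_gt (jneg nu) mF.
have := lsc_integral_gt (P \- jpos nu) mF.
case: (lsc_integral (P \- jpos nu) F) => [r||] //;
  case: (lsc_integral (jpos nu) F) => [a||] //;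
  case: (lsc_integral (jneg nu) F) => [b||] // _ _ _ _; split;
  rewrite ?ltry; try (by left); rewrite //=.
by congr EFin; lra.
Qed.

(** Any decomposition is allowed because Jordan parts are not additive: in this form the relation is
    visibly linear in nu, and [integratesP] recovers the value defined through the Jordan parts. *)
Definition integrates F nu (r : R) := radon R T nu /\
  exists P N a b, [/\ radon_pos R T P /\ radon_pos R T N, nu = P \- N,
    lsc_integral P F = a%:E, lsc_integral N F = b%:E & r = a - b].

Lemma integratesP F nu r : minorized F -> integrates F nu r ->
  integral_def nu F /\ signed_integral nu F = r%:E.
Proof.
move=> mF [rnu [P [N [a [b [[pP pN] nuE Pa Nb ->]]]]]].
have [|h1 ->] := signed_integral_split rnu pP pN nuE mF.
  by rewrite Pa ltry.
by rewrite Pa Nb.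
Qed.

Lemma integrates_pos F mu r : minorized F -> radon_pos R T mu ->
  lsc_integral mu F = r%:E -> integrates F mu r.
Proof.
move=> mF pmu mur; split; first exact: pos_radon.
exists mu, (fun f => 0 * mu f), r, 0; split => //.
- by split => //; apply: pos_scale.
- by apply/funext => f /=; rewrite mul0r subr0.
- by have := lsc_integralZ (lexx 0) pmu mF mur; rewrite mul0r.
- by rewrite subr0.
Qed.

Lemma integrates_combo F mu nu r t c d : minorized F -> integrates F mu r ->
  integrates F nu t -> integrates F (fun f => c * mu f + d * nu f) (c * r + d * t).
Proof.
have scale m c' r' : minorized F -> integrates F m r' ->
    integrates F (fun f => c' * m f) (c' * r').
  move=> mF [rm [P [N [a [b [[pP pN] mE Pa Nb rE]]]]]]; split.
    have := radon_combo c' 0 rm rm.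
    by congr radon; apply/funext => f; rewrite mul0r addr0.
  have [c0|c0] := leP 0 c'.
    exists (fun f => c' * P f), (fun f => c' * N f), (c' * a), (c' * b); split.
    - by split; exact: pos_scale.
    - by apply/funext => f; rewrite mE /=; lra.
    - exact: lsc_integralZ.
    - exact: lsc_integralZ.
    - by rewrite rE; lra.
  have c0' : 0 <= - c' by lra.
  exists (fun f => - c' * N f), (fun f => - c' * P f), (- c' * b), (- c' * a); split.
  - by split; exact: pos_scale.
  - by apply/funext => f; rewrite mE /=; lra.
  - exact: lsc_integralZ.
  - exact: lsc_integralZ.
  - by rewrite rE; lra.
move=> mF /(scale _ c _ mF) + /(scale _ d _ mF).
move=> [rm [P [N [a [b [[pP pN] mE Pa Nb ->]]]]]].
move=> [rm' [P' [N' [a' [b' [[pP' pN'] mE' Pa' Nb' ->]]]]]]; split.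
  exact: (radon_add rm rm').
exists (P \+ P'), (N \+ N'), (a + a'), (b + b'); split.
- by split; exact: pos_add.
- apply/funext => f /=; have /= -> := congr1 (fun u => u f) mE.
  by have /= -> := congr1 (fun u => u f) mE'; lra.
- by rewrite lsc_integralD // Pa Pa'.
- by rewrite lsc_integralD // Nb Nb'.
- lra.
Qed.

End split.

(** Near each point a single member of D is enough, by continuity of [w - h]; directedness merges
    finitely many of them. Staying above [f0] controls the function outside K later on. *)
Lemma dini (D : set (T -> R)) f0 h (K : set T) e : D f0 ->
  (forall f, D f -> continuous f) ->
  (forall f f', D f -> D f' -> exists w, [/\ D w, forall x, f x <= w x &
     forall x, f' x <= w x]) ->
  continuous h ->
  (forall x c, c < h x -> exists2 f, D f & c < f x) ->
  compact K -> 0 < e ->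
  exists f, [/\ D f, forall x, f0 x <= f x & forall x, K x -> h x - e < f x].
Proof.
move=> Df0 Dc Ddir ch Dsup cK e0.
apply: (@compact_ind T K (fun K => exists f, [/\ D f, forall x, f0 x <= f x &
  forall x, K x -> h x - e < f x])) => //.
- by exists f0; split.
- by move=> A B AB [f [Df ff0 fB]]; exists f; split => // x /AB/fB.
- move=> A B [f [Df ff0 fA]] [f' [Df' ff0' fB]].
  have [w [Dw fw fw']] := Ddir _ _ Df Df'; exists w; split => //.
    by move=> x; exact: le_trans (ff0 x) (fw x).
  by move=> x [/fA|/fB] h'; apply: lt_le_trans h' _.
- move=> x Kx.
  have [|f Df fx] := Dsup x (h x - e); first lra.
  have [w [Dw fw fw']] := Ddir _ _ Df Df0.
  exists [set y | 0 < w y - h y + e]; last first.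
    by exists w; split => // y /=; lra.
  have cw : continuous (fun y => w y - h y + e).
    apply: continuousDf; last exact: cst_continuous.
    by apply: continuousDf; [exact: Dc|exact: continuousNf].
  by apply: (nbhs_gt cw); have := fw x; lra.
Qed.

Hypothesis lT : locally_compact [set: T].

(* Off a common compact set the members of D lie above f0, hence above h, where
   both f0 and h vanish. *)
Lemma lsc_integral_dini mu F (D : set (T -> R)) f0 c : radon_pos R T mu ->
  D `<=` Cc R T -> D f0 ->
  (forall f f', D f -> D f' -> exists w, [/\ D w, forall x, f x <= w x &
     forall x, f' x <= w x]) ->
  (forall x r, (r%:E < F x)%E -> exists2 f, D f & r < f x) ->
  (forall f, D f -> ((mu f)%:E <= c)%E) ->
  (lsc_integral mu F <= c)%E.
Proof.
move=> pmu DC Df0 Ddir Dsup Dc; apply: lsc_integral_le => h Ch hF.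
have [ch [K cK hK]] := iffLR (CcP hT h) Ch.
have [cf0 [K0 cK0 f0K]] := iffLR (CcP hT f0) (DC _ Df0).
have [w [Cw w0 w1]] := @Cc_ge1 R T hT lT _ (compactU cK cK0).
have mw : 0 <= mu w by exact: pos_ge0.
apply/lee_addgt0Pr => e e0.
have e1 : 0 < e / (mu w + 1) by apply: divr_gt0 => //; lra.
have [|||f [Df ff0 fh]] := @dini D f0 h (K `|` K0) _ Df0 _ Ddir ch _ _ e1.
- by move=> f /DC; exact: Cc_cont.
- by move=> x r rh; apply: Dsup; apply: lt_le_trans (hF x); rewrite lte_fin.
- exact: compactU.
apply: (@le_trans _ _ ((mu f)%:E + e%:E)%E); last by rewrite leeD2r // Dc.
rewrite -EFinD lee_fin.
have Cfw : Cc R T (fun x => f x + (e / (mu w + 1)) * w x).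
  by apply: (CcD hT); [exact: DC|exact: CcZ].
have : mu h <= mu (fun x => f x + (e / (mu w + 1)) * w x).
  apply: (pos_le hT) => // x; have [Kx|nKx] := pselect ((K `|` K0) x).
    have := fh x Kx; have := ler_wpM2l (ltW e1) (w1 x Kx); lra.
  rewrite hK; last by move=> ?; apply: nKx; left.
  have := ff0 x; rewrite f0K; last by move=> ?; apply: nKx; right.
  have : 0 <= e / (mu w + 1) * w x by rewrite mulr_ge0 // ltW.
  by lra.
have rmu := pos_radon pmu.
rewrite (radonD rmu) //; [|exact: DC|exact: CcZ].
rewrite (@radonZ _ _ hT mu (e / (mu w + 1)) w rmu Cw).
have : e / (mu w + 1) * mu w <= e.
  by rewrite mulrAC ler_pdivrMr; [nra|lra].
by lra.
Qed.

Lemma lsc_sup_Cc F x r : lower_semicontinuous F -> minorized F ->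
  (r%:E < F x)%E ->
  exists f, [/\ Cc R T f, forall y, ((f y)%:E <= F y)%E & r < f x].
Proof.
move=> lF [f0 Cf0 f0F] rF.
have [rf0|f0r] := ltP r (f0 x); first by exists f0.
have [q rq qF] : exists2 q, r < q & (q%:E < F x)%E.
  case: (F x) rF => [y||] // => [|_]; last by exists (r + 1); rewrite ?ltry //; lra.
  by rewrite lte_fin => ry; exists ((r + y) / 2); rewrite ?lte_fin; lra.
(* With this height [f0 + s * w] takes at x the midpoint of r and q. Where w is nonzero, [f0]
   exceeds [f0 x] by less than half the gap, so the sum stays below q, which is below F there. *)
pose s := (q - f0 x + (r - f0 x)) / 2.
have s0 : 0 < s by rewrite /s; lra.
pose d := (q - r) / 2.
have [V xV VF] := lF x q qF.
have cf0 : continuous (fun y => - f0 y) by apply: continuousNf; exact: Cc_cont.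
have xW : nbhs x (V `&` [set y | - f0 x - d < - f0 y]).
  by apply: filterI => //; apply: (nbhs_gt cf0); rewrite /d; lra.
have [w [Cw w01 wx wV]] := Cc_bump (R := R) hT lT xW.
exists (fun y => f0 y + s * w y); split.
- by apply: (CcD hT) => //; exact: CcZ.
- move=> y; have [[Vy /= f0y]|/wV ->] := pselect ((V `&` [set y | - f0 x - d < - f0 y]) y).
    apply/ltW; apply: le_lt_trans (VF y Vy); rewrite lee_fin.
    have /andP[_ wy] := w01 y; have := ler_wpM2l (ltW s0) wy.
    by rewrite /s; move: f0y; rewrite /d; lra.
  by rewrite mulr0 addr0.
- by rewrite wx /s; lra.
Qed.

(** Sums of a minorant of F and a minorant of H form an upward directed family with supremum F + H,
    on which mu is additive. This makes the outer measure used below subadditive. *)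
Lemma lsc_integral_addfun mu F H : radon_pos R T mu ->
  lower_semicontinuous F -> lower_semicontinuous H ->
  minorized F -> minorized H ->
  (lsc_integral mu (fun x => F x + H x) <= lsc_integral mu F + lsc_integral mu H)%E.
Proof.
move=> pmu lF lH mF mH; have [f0 Cf0 f0F] := mF; have [h0 Ch0 h0H] := mH.
have rmu := pos_radon pmu.
apply: (@lsc_integral_dini mu _ [set w | exists f h, [/\ Cc R T f /\ Cc R T h,
  forall x, ((f x)%:E <= F x)%E, forall x, ((h x)%:E <= H x)%E
  & w = fun x => f x + h x]] (fun x => f0 x + h0 x)) => //.
- by move=> _ [f [h [[Cf Ch] _ _ ->]]]; exact: CcD.
- by exists f0, h0.
- move=> _ _ [f [h [[Cf Ch] fF hH ->]]] [f' [h' [[Cf' Ch'] fF' hH' ->]]].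
  exists (fun x => Num.max (f x) (f' x) + Num.max (h x) (h' x)); split.
  + exists (fun x => Num.max (f x) (f' x)), (fun x => Num.max (h x) (h' x)).
    split => //; first by split; exact: Cc_max.
    * by move=> x; rewrite EFin_max ge_max fF fF'.
    * by move=> x; rewrite EFin_max ge_max hH hH'.
  + by move=> x; apply: lerD; rewrite le_max lexx.
  + by move=> x; apply: lerD; rewrite le_max lexx orbT.
- move=> x r /lte_add_split[||s [t [/(lsc_sup_Cc lF mF)[f [Cf fF sf]]
    /(lsc_sup_Cc lH mH)[h [Ch hH th]] rst]]]; try exact: minorized_gt.
  exists (fun x => f x + h x); last by lra.
  by exists f, h.
- move=> _ [f [h [[Cf Ch] fF hH ->]]]; rewrite (radonD rmu) // EFinD.
  by apply: leeD; exact: le_lsc_integral.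
Qed.

(** Monotone convergence: the [Cc] minorants of the various [Fn n] form a directed family, since two
    of them lie below a common [Fn]. *)
Lemma lsc_integral_incr mu F (Fn : nat -> T -> \bar R) c : radon_pos R T mu ->
  (forall n, lower_semicontinuous (Fn n)) -> minorized (Fn 0%N) ->
  (forall n x, Fn n x <= Fn n.+1 x)%E ->
  (forall x r, (r%:E < F x)%E -> exists n, (r%:E < Fn n x)%E) ->
  (forall n, (lsc_integral mu (Fn n) <= c)%E) ->
  (lsc_integral mu F <= c)%E.
Proof.
move=> pmu lFn mF0 Finc Fsup Fc.
have incr n m x : (n <= m)%N -> (Fn n x <= Fn m x)%E.
  move=> nm; rewrite -(subnKC nm); elim: (m - n)%N => [|j ih]; first by rewrite addn0.
  by rewrite addnS; exact: le_trans ih (Finc _ _).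
have mF n : minorized (Fn n).
  case: mF0 => f Cf fF; exists f => // x; apply: le_trans (fF x) _; exact: incr.
have [f0 Cf0 f0F] := mF0.
apply: (@lsc_integral_dini mu F [set f | Cc R T f /\ exists n, forall x,
  ((f x)%:E <= Fn n x)%E] f0) => //.
- by move=> f [].
- by split => //; exists 0%N.
- move=> f f' [Cf [n fn]] [Cf' [n' fn']].
  exists (fun x => Num.max (f x) (f' x)); split.
  + split; first exact: Cc_max.
    exists (maxn n n') => x; rewrite EFin_max ge_max.
    rewrite (le_trans (fn x)) ?(le_trans (fn' x)) //; apply: incr.
      exact: leq_maxr.
    exact: leq_maxl.
  + by move=> x; rewrite le_max lexx.
  + by move=> x; rewrite le_max lexx orbT.
- move=> x r /Fsup[n] /(lsc_sup_Cc (lFn n) (mF n))[f [Cf fF rf]].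
  by exists f => //; split => //; exists n.
- by move=> f [Cf [n fn]]; apply: le_trans (Fc n); exact: le_lsc_integral.
Qed.

End lsc_integral.

(** * Product measures *)

Section product_space.
Context {R : realType} {X : topologicalType} (hX : hausdorff_space X).
Implicit Types (f h : X -> R) (F : X * X -> R) (mu nu tau : (X -> R) -> R).

Let hXX : hausdorff_space (X * X)%type := hausdorff_setX hX hX.

Lemma continuous_fst : continuous (@fst X X).
Proof. by move=> x; exact: cvg_fst. Qed.

Lemma continuous_snd : continuous (@snd X X).
Proof. by move=> x; exact: cvg_snd. Qed.

Lemma continuous_pairl (x : X) : continuous (fun y : X => (x, y)).
Proof. by move=> y; apply: cvg_pair; [exact: cvg_cst|exact: cvg_id]. Qed.

Lemma Cc_square F : Cc R (X * X)%type F ->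
  exists2 K, compact K & forall x y, ~ (K x /\ K y) -> F (x, y) = 0.
Proof.
move=> /(CcP hXX)[cF [K cK FK]]; exists ((fst @` K) `|` (snd @` K)).
  apply: compactU; apply: continuous_compact => //;
    apply: continuous_subspaceT; [exact: continuous_fst|exact: continuous_snd].
move=> x y nK; apply: FK => Kxy; apply: nK; split.
  by left; exists (x, y).
by right; exists (x, y).
Qed.

Lemma Cc_sec F x : Cc R (X * X)%type F -> Cc R X (fun y => F (x, y)).
Proof.
move=> CF; have [K cK FK] := Cc_square CF; apply/(CcP hX); split.
  move=> y; apply: (@continuous_comp _ _ _ (fun y => (x, y)) F).
    exact: continuous_pairl.
  exact: (Cc_cont CF).
by exists K => // y nKy; apply: FK => -[].
Qed.

(** Uniformity in y comes from compactness of K, outside which both sections vanish; it yields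
    continuity of partial integrals. *)
Lemma sec_unif F (x0 : X) e : Cc R (X * X)%type F -> 0 < e ->
  exists2 V, nbhs x0 V & forall x y, V x -> `|F (x, y) - F (x0, y)| <= e.
Proof.
move=> CF e0; have [K cK FK] := Cc_square CF.
have [V xV VK] : exists2 V, nbhs x0 V &
    forall x y, V x -> K y -> `|F (x, y) - F (x0, y)| <= e.
  apply: (@compact_ind X K (fun K => exists2 V, nbhs x0 V &
    forall x y, V x -> K y -> `|F (x, y) - F (x0, y)| <= e)) => //.
  - by exists setT => //; exact: filterT.
  - by move=> A B AB [V xV H]; exists V => // x y Vx /AB; exact: H.
  - move=> A B [V xV HV] [W xW HW]; exists (V `&` W); first exact: filterI.
    by move=> x y [Vx Wx] [Ay|By]; [exact: HV|exact: HW].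
  - move=> y Ky; have e2 : 0 < e / 2 by lra.
    have cF := Cc_cont CF.
    have /cvgrPdist_lt/(_ _ e2)[[V W] /= [xV yW] VW] := cF (x0, y).
    exists W => //; exists V => // x z Vx Wz.
    have x0V : V x0 by exact: nbhs_singleton.
    have /= h1 := VW (x, z) (conj Vx Wz).
    have /= h2 := VW (x0, z) (conj x0V Wz).
    have -> : F (x, z) - F (x0, z) =
      (F (x0, y) - F (x0, z)) - (F (x0, y) - F (x, z)) by lra.
    by apply: (le_trans (ler_normB _ _)); lra.
exists V => // x y Vx; have [Ky|nKy] := pselect (K y); first exact: VK.
by rewrite !FK ?subrr ?normr0 ?(ltW e0) //; move=> [].
Qed.

Lemma Cc_int nu F : radon R X nu -> Cc R (X * X)%type F ->
  Cc R X (fun x => nu (fun y => F (x, y))).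
Proof.
move=> rnu CF; have [K cK FK] := Cc_square CF; apply/(CcP hX); split; last first.
  exists K => // x nKx; rewrite -(radon0 hX rnu); congr nu; apply/funext => y.
  by apply: FK => -[].
move=> x0; apply/cvgrPdist_le => e e0.
have [M M0 HM] := radon_bound hX rnu cK.
have e1 : 0 < e / (M + 1) by apply: divr_gt0 => //; lra.
have [V xV HV] := sec_unif x0 CF e1.
apply: filterS xV => x Vx; rewrite -(radonB hX rnu); [|exact: Cc_sec|exact: Cc_sec].
apply: (@le_trans _ _ (M * (e / (M + 1)))); last first.
  by rewrite mulrCA ler_piMr ?(ltW e0) // ler_pdivrMr; lra.
apply: HM.
- by apply: (CcB hX); exact: Cc_sec.
- by move=> y nKy; rewrite !FK ?subrr //; move=> [].
- exact: ltW.
- by move=> y; rewrite distrC; exact: HV.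
Qed.

Lemma prodE nu mu F : Cc R (X * X)%type F ->
  product_measure nu mu F = nu (fun x => mu (fun y => F (x, y))).
Proof. by move=> CF; rewrite /product_measure /on_Cc; case: asboolP. Qed.

Lemma product_out nu mu F : ~ Cc R (X * X)%type F -> product_measure nu mu F = 0.
Proof. by move=> CF; rewrite /product_measure /on_Cc; case: asboolP. Qed.


Lemma product_combol s t nu nu' mu F :
  product_measure (fun f => s * nu f + t * nu' f) mu F =
  s * product_measure nu mu F + t * product_measure nu' mu F.
Proof.
have [CF|nCF] := pselect (Cc R (X * X)%type F); first by rewrite !prodE.
by rewrite !product_out // !mulr0 addr0.
Qed.

Lemma product_combor s t nu mu mu' F : radon R X nu -> radon R X mu ->
  radon R X mu' ->
  product_measure nu (fun f => s * mu f + t * mu' f) F =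
  s * product_measure nu mu F + t * product_measure nu mu' F.
Proof.
move=> rnu rmu rmu'; have [CF|nCF] := pselect (Cc R (X * X)%type F); last first.
  by rewrite !product_out // !mulr0 addr0.
have C1 := Cc_int rmu CF; have C2 := Cc_int rmu' CF.
rewrite !prodE // -(radonZ hX t rnu C2) -(radon_lin s rnu C1) //.
exact: CcZ.
Qed.

Definition tensor f h (z : X * X) := f z.1 * h z.2.

Lemma continuous_tensor f h : continuous f -> continuous h ->
  continuous (tensor f h).
Proof.
move=> cf ch; apply: continuousMf => z; apply: continuous_comp.
- exact: continuous_fst.
- exact: cf.
- exact: continuous_snd.
- exact: ch.
Qed.

Lemma Cc_tensor f h : Cc R X f -> Cc R X h -> Cc R (X * X)%type (tensor f h).
Proof.
move=> /(CcP hX)[cf [K cK fK]] /(CcP hX)[ch [L cL hL]]; apply/(CcP hXX); split.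
  exact: continuous_tensor.
exists (K `*` L); first exact: compact_setX.
move=> [x y] nKL; rewrite /tensor /=.
have [Kx|/fK ->] := pselect (K x); last by rewrite mul0r.
have [Ly|/hL ->] := pselect (L y); last by rewrite mulr0.
by case: nKL.
Qed.

Lemma product_tensor nu mu f h : radon R X nu -> radon R X mu ->
  Cc R X f -> Cc R X h ->
  product_measure nu mu (tensor f h) = nu f * mu h.
Proof.
move=> rnu rmu Cf Ch; rewrite prodE; last exact: Cc_tensor.
rewrite mulrC -(radonZ hX _ rnu Cf); congr nu; apply/funext => x.
by rewrite /tensor /= (radonZ hX _ rmu Ch) mulrC.
Qed.

Hypothesis lX : locally_compact [set: X].
Let lXX : locally_compact [set: (X * X)%type] := locally_compact_setX hX hX lX lX.

Lemma product_pos nu mu : radon_pos R X nu -> radon_pos R X mu ->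
  radon_pos R (X * X)%type (product_measure nu mu).
Proof.
move=> pnu pmu; have rnu := pos_radon pnu; have rmu := pos_radon pmu.
apply: (radon_posI hXX lXX).
- exact: product_out.
- move=> c F G CF CG; rewrite !prodE //; last first.
    by apply: (CcD hXX) => //; exact: CcZ.
  rewrite -(radon_lin c rnu (Cc_int rmu CF) (Cc_int rmu CG)).
  congr nu; apply/funext => x.
  exact: (radon_lin c rmu (Cc_sec x CF) (Cc_sec x CG)).
- move=> F CF F0; rewrite prodE //; apply: (pos_ge0 pnu) => x.
  by apply: (pos_ge0 pmu).
Qed.

Lemma product_radon nu mu : radon R X nu -> radon R X mu ->
  radon R (X * X)%type (product_measure nu mu).
Proof.
move=> rnu rmu.
have jn := jpos_pos hX lX rnu; have jn' := jneg_pos hX lX rnu.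
have jm := jpos_pos hX lX rmu; have jm' := jneg_pos hX lX rmu.
have sub2 m : radon R X m ->
    m = fun f => 1 * jpos m f + (-1) * jneg m f.
  by move=> rm; apply/funext => f; rewrite {1}(jordanE hX lX rm) /=; lra.
rewrite (sub2 nu rnu).
have -> : product_measure (fun f => 1 * jpos nu f + -1 * jneg nu f) mu =
  fun F => 1 * product_measure (jpos nu) mu F + (-1) * product_measure (jneg nu) mu F.
  by apply/funext => F; exact: product_combol.
suff H m : radon_pos R X m -> radon R (X * X)%type (product_measure m mu).
  by apply: radon_combo; exact: H.
move=> pm; rewrite (sub2 mu rmu).
have -> : product_measure m (fun f => 1 * jpos mu f + -1 * jneg mu f) =
  fun F => 1 * product_measure m (jpos mu) F + (-1) * product_measure m (jneg mu) F.
  by apply/funext => F; apply: product_combor; exact: pos_radon.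
by apply: radon_combo; apply: pos_radon; exact: product_pos.
Qed.

(* F is uniformly close to m u = sum_i (m psi_i) (x) F(x_i, .), where the psi_i
   form a partition of the compact support after multiplication by m. *)
Lemma tensor_pos (G : (X * X -> R) -> R) : radon R (X * X)%type G ->
  (forall f h, Cc R X f -> Cc R X h -> (forall x, 0 <= f x) ->
     (forall x, 0 <= h x) -> 0 <= G (tensor f h)) ->
  radon_pos R (X * X)%type G.
Proof.
move=> rG GT; split => // F CF F0.
have [K cK FK] := Cc_square CF.
have [w [Cw w0 w1]] := @Cc_ge1 R X hX lX K cK.
have [cw [L cL wL]] := iffLR (CcP hX w) Cw.
have cLK : compact ((L `|` K) `*` K) by apply: compact_setX => //; exact: compactU.
have [M M0 HM] := radon_bound hXX rG cLK.
suff H e : 0 < e -> 0 <= G F + M * e.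
  rewrite leNgt; apply/negP => G0.
  pose q := - G F / (M + 1).
  have q0 : 0 < q by apply: divr_gt0; lra.
  have qE : q * (M + 1) = - G F by rewrite divfK //; lra.
  by have := H _ q0; lra.
move=> e0.
(* The normalizing factor depends on the final S, so the induction carries positivity of G on [u]
   times every continuous m >= 0. The error is measured relative to S in order to add up when covers
   are merged. *)
have [S [u [CS S0 S1 Cu [uF uK uG]]]] : exists S u, [/\ Cc R X S,
    forall x, 0 <= S x, forall x, K x -> 1 <= S x, Cc R (X * X)%type u &
    [/\ forall x y, `|u (x, y) - S x * F (x, y)| <= e * S x,
        forall x y, ~ K y -> u (x, y) = 0
      & forall m : X -> R, continuous m -> (forall x, 0 <= m x) ->
          0 <= G (fun z => u z * m z.1)]].
  apply: (@compact_ind X K (fun K' => exists S u, [/\ Cc R X S,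
    forall x, 0 <= S x, forall x, K' x -> 1 <= S x, Cc R (X * X)%type u &
    [/\ forall x y, `|u (x, y) - S x * F (x, y)| <= e * S x,
        forall x y, ~ K y -> u (x, y) = 0
      & forall m : X -> R, continuous m -> (forall x, 0 <= m x) ->
          0 <= G (fun z => u z * m z.1)]])) => //.
  - exists (fun=> 0), (fun=> 0); split => //; [exact: Cc0|exact: Cc0|].
    split => // [x y|m cm m0]; first by rewrite mul0r subrr normr0 mulr0.
    rewrite (_ : (fun z : X * X => 0 * m z.1) = fun=> 0) ?(radon0 hXX rG) //.
    by apply/funext => z; rewrite mul0r.
  - by move=> A B AB [S [u [? ? H ? ?]]]; exists S, u; split => // x /AB/H.
  - move=> A B [S [u [CS S0 S1 Cu [uF uK uG]]]] [S' [u' [CS' S0' S1' Cu' [uF' uK' uG']]]].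
    exists (fun x => S x + S' x), (fun z => u z + u' z); split.
    + exact: CcD.
    + by move=> x; rewrite addr_ge0.
    + by move=> x [/S1|/S1']; [have := S0' x|have := S0 x]; lra.
    + exact: CcD.
    split.
    + move=> x y.
      rewrite (_ : _ - _ = (u (x, y) - S x * F (x, y)) +
          (u' (x, y) - S' x * F (x, y))); last lra.
      by apply: (le_trans (ler_normD _ _)); have := uF x y; have := uF' x y; lra.
    + by move=> x y nK; rewrite uK // uK' // addr0.
    + move=> m cm m0.
      have cm1 : continuous (fun z : X * X => m z.1).
        move=> z; apply: continuous_comp; first exact: continuous_fst.
        exact: cm.
      rewrite (_ : (fun z => _) = fun z => u z * m z.1 + u' z * m z.1); last first.
        by apply/funext => z; rewrite mulrDl.
      rewrite (radonD rG); [|exact: CcMr|exact: CcMr].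
      by rewrite addr_ge0 ?uG ?uG'.
  - move=> x0 Kx0; have [V xV VF] := sec_unif x0 CF e0.
    have [p [Cp p01 px pV]] := Cc_bump (R := R) hX lX xV.
    have p0 x : 0 <= p x by have /andP[] := p01 x.
    exists [set x | 2^-1 < p x].
      by apply: nbhs_gt; [exact: (Cc_cont Cp)|rewrite px; lra].
    have C2p := CcZ hX 2 Cp; have CF0 := Cc_sec x0 CF.
    exists (fun x => 2 * p x), (tensor (fun x => 2 * p x) (fun y => F (x0, y))).
    split => //.
    + by move=> x; rewrite mulr_ge0.
    + by move=> x /=; lra.
    + exact: Cc_tensor.
    split.
    + move=> x y; rewrite /tensor /= -mulrBr normrM ger0_norm ?mulr_ge0 //.
      rewrite mulrC; have [Vx|nVx] := pselect (V x).
        by apply: ler_wpM2r; [rewrite mulr_ge0|rewrite distrC VF].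
      by rewrite pV // !mulr0.
    + by move=> x y nKy; rewrite /tensor /= FK ?mulr0 //; move=> [].
    + move=> m cm m0.
      rewrite (_ : (fun z => _) =
          tensor (fun x => 2 * p x * m x) (fun y => F (x0, y))); last first.
        by apply/funext => z; rewrite /tensor /= mulrAC.
      apply: GT => //; first exact: CcMr.
      by move=> x; rewrite !mulr_ge0.
(* Truncating at 1 makes the quotient continuous everywhere, with [m * S] equal to 1 on K and at
   most 1 elsewhere; the factor from w gives m compact support. *)
pose m x := Num.min (w x) 1 / Num.max (S x) 1.
have max1 x : 0 < Num.max (S x) 1 by rewrite lt_max ltr01 orbT.
have cm : continuous m.
  apply: continuousMf.
    by apply: continuous_minf => //; exact: cst_continuous.
  move=> x; apply: cvgV; first by rewrite gt_eqF.
  have := continuous_maxf (Cc_cont CS) (@cst_continuous _ R^o 1); exact.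
have m0 x : 0 <= m x.
  by rewrite /m divr_ge0 ?(ltW (max1 x)) // le_min w0 ler01.
have mS x : m x * S x <= 1.
  rewrite /m mulrAC ler_pdivrMr // mul1r.
  apply: (@le_trans _ _ (S x)); last by rewrite le_max lexx.
  by rewrite ler_piMl // ge_min lexx orbT.
have mS1 x : K x -> m x * S x = 1.
  move=> Kx; rewrite /m (min_idPr _) ?w1 // (max_idPl _) ?S1 // mul1r mulVf //.
  by rewrite gt_eqF //; have := S1 _ Kx; lra.
have Cum : Cc R (X * X)%type (fun z => u z * m z.1).
  apply: (CcMr hXX) => // z; apply: continuous_comp; first exact: continuous_fst.
  exact: cm.
have h1 := uG m cm m0.
have : `|G (fun z => F z - u z * m z.1)| <= M * e.
  apply: HM; [exact: CcB| |exact: ltW|].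
  - move=> [x y] nLK /=; have [Ky|nKy] := pselect (K y); last first.
      by rewrite uK // FK ?mul0r ?subrr // => -[].
    have nLx : ~ L x by move=> ?; apply: nLK; split => //; left.
    have nKx : ~ K x by move=> ?; apply: nLK; split => //; right.
    rewrite FK ?add0r; last by move=> [].
    by rewrite /m wL // (min_idPl _) ?ler01 // mul0r mulr0 oppr0.
  - move=> [x y] /=.
    have -> : F (x, y) - u (x, y) * m x = - (m x * (u (x, y) - S x * F (x, y)))
        + (1 - m x * S x) * F (x, y) by lra.
    have -> : (1 - m x * S x) * F (x, y) = 0.
      have [Kx|nKx] := pselect (K x); first by rewrite mS1 // subrr mul0r.
      by rewrite FK ?mulr0 //; move=> [].
    rewrite addr0 normrN normrM (ger0_norm (m0 x)).
    apply: (le_trans (ler_wpM2l (m0 x) (uF x y))).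
    by rewrite mulrCA ler_piMr // ltW.
rewrite (radonB hXX rG) // ler_norml => /andP[+ _].
by lra.
Qed.

Lemma tensor_eq (G H : (X * X -> R) -> R) : radon R (X * X)%type G ->
  radon R (X * X)%type H ->
  (forall f h, Cc R X f -> Cc R X h -> G (tensor f h) = H (tensor f h)) -> G = H.
Proof.
move=> rG rH GH.
have /(_ _)[|_ p1] := tensor_pos (radon_sub rG rH).
  by move=> f h Cf Ch _ _ /=; rewrite GH // subrr.
have /(_ _)[|_ p2] := tensor_pos (radon_sub rH rG).
  by move=> f h Cf Ch _ _ /=; rewrite GH // subrr.
apply: (radon_ext hXX) => // F CF F0.
by have /= := p1 F CF F0; have /= := p2 F CF F0; lra.
Qed.

Lemma Cc_swap F : Cc R (X * X)%type F -> Cc R (X * X)%type (fun z => F (z.2, z.1)).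
Proof.
move=> CF; have [K cK FK] := Cc_square CF; apply/(CcP hXX); split.
  move=> z; apply: (@continuous_comp _ _ _ (fun z : X * X => (z.2, z.1)) F).
    by apply: cvg_pair; [exact: continuous_snd|exact: continuous_fst].
  exact: (Cc_cont CF).
exists (K `*` K); first exact: compact_setX.
by move=> [x y] nK; apply: FK => -[Ky Kx]; apply: nK.
Qed.

(** Fubini on [Cc]: both sides are Radon measures in F with the same values on tensor products,
    hence equal by [tensor_eq]. *)
Lemma product_swap nu mu F : radon_pos R X nu -> radon_pos R X mu ->
  Cc R (X * X)%type F ->
  product_measure nu mu F = product_measure mu nu (fun z => F (z.2, z.1)).
Proof.
move=> pnu pmu CF; have rnu := pos_radon pnu; have rmu := pos_radon pmu.
pose H := on_Cc (fun F => product_measure mu nu (fun z => F (z.2, z.1))).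
have HE F' : Cc R (X * X)%type F' ->
    H F' = product_measure mu nu (fun z => F' (z.2, z.1)).
  by move=> CF'; rewrite /H /on_Cc; case: asboolP.
rewrite -HE //; congr (_ F); have rP := product_radon rmu rnu.
apply: tensor_eq; first exact: product_radon.
  apply: pos_radon; apply: (radon_posI hXX lXX).
  - by move=> F' nF'; rewrite /H /on_Cc; case: asboolP.
  - move=> c F1 F2 C1 C2; rewrite !HE //; last first.
      by apply: (CcD hXX) => //; exact: CcZ.
    exact: (radon_lin c rP (Cc_swap C1) (Cc_swap C2)).
  - move=> F' CF' F0; rewrite HE //.
    by apply: pos_ge0 => //; exact: product_pos.
move=> f h Cf Ch; rewrite HE; last exact: Cc_tensor.
rewrite product_tensor // (_ : (fun z => _) = tensor h f).
  by rewrite product_tensor // mulrC.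
by apply/funext => z; rewrite /tensor /= mulrC.
Qed.

(* |nu| (x) |nu| <= |nu (x) nu|, as the inequality holds on tensor products. *)
Lemma abs_product nu (P := product_measure nu nu) (m := jpos nu \+ jneg nu) :
  radon R X nu ->
  radon_pos R (X * X)%type ((jpos P \+ jneg P) \- product_measure m m).
Proof.
move=> rnu; have rP := product_radon rnu rnu.
have pm : radon_pos R X m.
  by apply: pos_add; [exact: (jpos_pos hX lX)|exact: (jneg_pos hX lX)].
have pP : radon_pos R (X * X)%type (jpos P \+ jneg P).
  by apply: pos_add; [exact: (jpos_pos hXX lXX)|exact: (jneg_pos hXX lXX)].
have rm := pos_radon pm.
apply: tensor_pos.
  by apply: radon_sub; [exact: pos_radon|exact: product_radon].
move=> f h Cf Ch f0 h0 /=.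
rewrite product_tensor // subr_ge0.
set C := jpos P _ + _; have C0 : 0 <= C.
  by apply: (pos_ge0 pP) => z; rewrite mulr_ge0.
have H a b : Cc R X a -> Cc R X b -> (forall x, `|a x| <= f x) ->
    (forall x, `|b x| <= h x) -> nu a * nu b <= C.
  move=> Ca Cb af bh; rewrite -product_tensor //.
  apply: (abs_ub hXX lXX) => //; try exact: Cc_tensor.
  by move=> z; rewrite /tensor normrM ler_pM.
have key t h' : Cc R X h' -> (forall x, 0 <= h' x) ->
    (forall b, Cc R X b -> (forall x, `|b x| <= h' x) -> t * nu b <= C) ->
    t * m h' <= C.
  move=> Ch' h'0 H'; have [t0|t0] := leP t 0.
    by apply: (le_trans _ C0); rewrite mulr_le0_ge0 // (pos_ge0 pm).
  rewrite -ler_pdivlMl //; apply: (abs_le hX lX) => // b Cb bh.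
  by rewrite ler_pdivlMl //; exact: H'.
rewrite mulrC; apply: (key) => // a Ca af; rewrite mulrC.
by apply: (key) => // b Cb bh; exact: H.
Qed.

End product_space.

(** * Potentials of positive measures and iterated integration of the kernel *)

Section lsc_fubini.
Context {R : realType} {X : topologicalType} (hX : hausdorff_space X)
  (lX : locally_compact [set: X]).
Variable k : X * X -> \bar R.
Hypotheses (lk : lower_semicontinuous k) (mk : minorized k).
Implicit Types (f h : X -> R) (F : X * X -> R) (mu nu tau : (X -> R) -> R).

Let hXX : hausdorff_space (X * X)%type := hausdorff_setX hX hX.
Let lXX : locally_compact [set: (X * X)%type] := locally_compact_setX hX hX lX lX.

Definition pot mu (x : X) : \bar R := lsc_integral mu (fun y => k (x, y)).

Lemma minorized_sec x : minorized (fun y => k (x, y)).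
Proof.
case: mk => F CF Fk; exists (fun y => F (x, y)); first exact: (Cc_sec hX).
by move=> y; exact: Fk.
Qed.

Lemma pot_le mu x F : Cc R (X * X)%type F -> (forall z, ((F z)%:E <= k z)%E) ->
  ((mu (fun y => F (x, y)))%:E <= pot mu x)%E.
Proof.
move=> CF Fk; apply: le_lsc_integral; first exact: (Cc_sec hX).
by move=> y; exact: Fk.
Qed.

(** The minorants are taken on the whole product, not only on the section at x: their partial
    integrals are continuous in x, which is the source of lower semicontinuity and of Fubini. Their
    sections at x are directed with supremum [k (x, y)], so Dini applies. *)
Lemma pot_approx mu x r : radon_pos R X mu -> (r%:E < pot mu x)%E ->
  exists F, [/\ Cc R (X * X)%type F, forall z, ((F z)%:E <= k z)%E &
    r < mu (fun y => F (x, y))].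
Proof.
move=> pmu rp; apply: contrapT => H; have [F0 CF0 F0k] := mk.
suff : (pot mu x <= r%:E)%E by rewrite leNgt rp.
apply: (@lsc_integral_dini R X hX lX mu _ [set f | exists2 F,
  Cc R (X * X)%type F /\ (forall z, ((F z)%:E <= k z)%E) & f = fun y => F (x, y)]
  (fun y => F0 (x, y))) => //.
- by move=> _ [F [CF _] ->]; exact: (Cc_sec hX).
- by exists F0.
- move=> _ _ [F [CF Fk] ->] [G [CG Gk] ->].
  exists (fun y => Num.max (F (x, y)) (G (x, y))); split.
  + exists (fun z => Num.max (F z) (G z)) => //; split; first exact: (Cc_max hXX).
    by move=> z; rewrite EFin_max ge_max Fk Gk.
  + by move=> y; rewrite le_max lexx.
  + by move=> y; rewrite le_max lexx orbT.
- move=> y s /(lsc_sup_Cc hXX lXX lk mk)[F [CF Fk sF]].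
  by exists (fun y => F (x, y)) => //; exists F.
- move=> _ [F [CF Fk] ->]; rewrite lee_fin leNgt; apply/negP => rF.
  by apply: H; exists F.
Qed.

Lemma pot_lsc mu : radon_pos R X mu -> lower_semicontinuous (pot mu).
Proof.
move=> pmu x r /(pot_approx pmu)[F [CF Fk rF]].
exists [set x | r < mu (fun y => F (x, y))].
  by apply: (@nbhs_gt _ _ (fun x => mu (fun y => F (x, y)))) => //;
    exact: Cc_cont (Cc_int hX (pos_radon pmu) CF).
by move=> y /= ry; apply: lt_le_trans (pot_le _ _ CF Fk); rewrite lte_fin.
Qed.

Lemma pot_minorized mu : radon_pos R X mu -> minorized (pot mu).
Proof.
move=> pmu; case: mk => F CF Fk; exists (fun x => mu (fun y => F (x, y))).
  exact: (Cc_int hX (pos_radon pmu) CF).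
by move=> x; exact: pot_le.
Qed.

(** The partial integrals against mu of the [Cc] minorants of k are directed and have supremum
    [pot mu], so the outer integral passes to the supremum. *)
Lemma lsc_fubini tau mu : radon_pos R X tau -> radon_pos R X mu ->
  lsc_integral (product_measure tau mu) k = lsc_integral tau (pot mu).
Proof.
move=> ptau pmu; have rmu := pos_radon pmu; have rtau := pos_radon ptau.
have [F0 CF0 F0k] := mk.
apply/eqP; rewrite eq_le; apply/andP; split.
  apply: lsc_integral_le => F CF Fk; rewrite prodE //.
  apply: (@le_lsc_integral _ _ _ (pot mu)); first exact: (Cc_int hX rmu CF).
  by move=> x; exact: pot_le.
apply: (@lsc_integral_dini R X hX lX tau _ [set f | exists2 F,
  Cc R (X * X)%type F /\ (forall z, ((F z)%:E <= k z)%E) &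
  f = fun x => mu (fun y => F (x, y))]
  (fun x => mu (fun y => F0 (x, y)))) => //.
- by move=> _ [F [CF _] ->]; exact: (Cc_int hX rmu CF).
- by exists F0.
- move=> _ _ [F [CF Fk] ->] [G [CG Gk] ->].
  have CM := Cc_max hXX CF CG.
  exists (fun x => mu (fun y => Num.max (F (x, y)) (G (x, y)))); split.
  + exists (fun z => Num.max (F z) (G z)) => //; split => //.
    by move=> z; rewrite EFin_max ge_max Fk Gk.
  + move=> x; apply: (pos_le hX) => //; [exact: (Cc_sec hX)|exact: (Cc_sec hX x CM)|].
    by move=> y; rewrite le_max lexx.
  + move=> x; apply: (pos_le hX) => //; [exact: (Cc_sec hX)|exact: (Cc_sec hX x CM)|].
    by move=> y; rewrite le_max lexx orbT.
- move=> x r /(pot_approx pmu)[F [CF Fk rF]].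
  by exists (fun x => mu (fun y => F (x, y))) => //; exists F.
- move=> _ [F [CF Fk] ->]; rewrite -(prodE tau mu CF); exact: le_lsc_integral.
Qed.

Lemma lsc_integral_swap nu mu : (forall x y, k (x, y) = k (y, x)) ->
  radon_pos R X nu -> radon_pos R X mu ->
  lsc_integral (product_measure nu mu) k = lsc_integral (product_measure mu nu) k.
Proof.
move=> sk; suff H nu' mu' : radon_pos R X nu' -> radon_pos R X mu' ->
    (lsc_integral (product_measure nu' mu') k
     <= lsc_integral (product_measure mu' nu') k)%E.
  by move=> pnu pmu; apply/eqP; rewrite eq_le !H.
move=> pnu pmu; apply: lsc_integral_le => F CF Fk.
rewrite (product_swap hX lX pnu pmu CF); apply: le_lsc_integral.
  exact: (Cc_swap hX).
by move=> [x y] /=; rewrite sk; exact: Fk.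
Qed.

End lsc_fubini.

(** * The energy form *)

(** On a compact space a lower semicontinuous kernel without the value -oo is bounded below, and
    constants lie in [Cc]. *)
Lemma kernel_minorized (R : realType) (X : topologicalType)
    (hX : hausdorff_space X) (k : X * X -> \bar R) :
  energy_kernel k -> minorized k.
Proof.
move=> [lk kNy [cX|k0]]; last by apply: minorized_ge0 => //; exact: hausdorff_setX.
have cXX : compact [set: (X * X)%type].
  by rewrite -setXTT; exact: compact_setX.
have [r rk] : exists r : R, forall z, [set: (X * X)%type] z -> (r%:E <= k z)%E.
  apply: (@compact_ind (X * X)%type _ (fun A => exists r : R, forall z, A z ->
    (r%:E <= k z)%E)) => //.
  - by exists 0.
  - by move=> A B AB [r H]; exists r => z /AB/H.
  - move=> A B [r H] [s H']; exists (Num.min r s) => z [/H|/H'];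
      by apply: le_trans; rewrite lee_fin ge_min lexx ?orbT.
  - move=> z _; have [r rz] : exists r : R, (r%:E < k z)%E.
      have := kNy z; case: (k z) => [a||] // _; last by exists 0; rewrite ltry.
      by exists (a - 1); rewrite lte_fin; lra.
    have [V zV VH] := lk z r rz.
    by exists V => //; exists r => y /VH/ltW.
exists (fun=> r); last by move=> z; exact: rk.
apply/(CcP (hausdorff_setX hX hX)); split; first exact: cst_continuous.
by exists setT => // z nz; exfalso; exact: nz.
Qed.

Section energy.
Context {R : realType} {X : topologicalType} (hX : hausdorff_space X)
  (lX : locally_compact [set: X]).
Variable k : X * X -> \bar R.
Hypotheses (kk : energy_kernel k) (pk : positive_definite k).
Implicit Types (mu nu tau rho : (X -> R) -> R).

Let hXX : hausdorff_space (X * X)%type := hausdorff_setX hX hX.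
Let lXX : locally_compact [set: (X * X)%type] := locally_compact_setX hX hX lX lX.
Let mk : minorized k := kernel_minorized hX kk.
Let lk : lower_semicontinuous k. Proof. by case: kk. Qed.
Local Notation I mu nu := (lsc_integral (product_measure mu nu) k).

Lemma finite_energyP nu : radon R X nu -> finite_energy k nu <->
  exists r, integrates k (product_measure nu nu) r.
Proof.
move=> rnu; have rP := product_radon hX lX rnu rnu; split.
  move=> [_ _]; rewrite /energy /signed_integral.
  have := lsc_integral_gt (jpos (product_measure nu nu)) mk.
  have := lsc_integral_gt (jneg (product_measure nu nu)) mk.
  case En : (lsc_integral (jneg _) k) => [b||] // _;
    case Ep : (lsc_integral (jpos _) k) => [a||] // _ _.
  exists (a - b); split => //.
  exists (jpos (product_measure nu nu)), (jneg (product_measure nu nu)), a, b.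
  split => //; last exact: (jordanE hXX lXX).
  by split; [exact: (jpos_pos hXX lXX)|exact: (jneg_pos hXX lXX)].
move=> [r /(integratesP hXX lXX mk)[kd ke]]; split => //.
by rewrite /energy ke.
Qed.

Lemma knorm2E nu r : integrates k (product_measure nu nu) r ->
  knorm2 k nu = r%:E.
Proof. by move=> /(integratesP hXX lXX mk)[_]. Qed.

(** A positive measure lies below the positive part of each of its decompositions, so finiteness in
    the signed sense gives finiteness of the plain supremum. *)
Lemma pos_energy_fin (mu : (X * X -> R) -> R) r :
  radon_pos R (X * X)%type mu -> integrates k mu r ->
  (lsc_integral mu k < +oo)%E.
Proof.
move=> pmu [_ [P [N [a [b [[pP pN] muE Pa Nb _]]]]]].
apply: (@lsc_integral_dom_fin R _ hXX mu P) => //; last by rewrite Pa ltry.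
by rewrite (_ : P \- mu = N) //; apply/funext => f; rewrite muE /=; lra.
Qed.

Definition pos_energy mu := radon_pos R X mu /\ (I mu mu < +oo)%E.

Lemma pos_energyP mu : radon_pos R X mu -> finite_energy k mu <-> pos_energy mu.
Proof.
move=> pmu; have rmu := pos_radon pmu; have pP := product_pos hX lX pmu pmu.
split=> [/(finite_energyP rmu)[r /(pos_energy_fin pP)]//|[_ Ifin]].
have : (-oo < I mu mu)%E by exact: lsc_integral_gt.
case Er : (I mu mu) Ifin => [r||] // _ _; apply/finite_energyP => //; exists r.
exact: (integrates_pos).
Qed.

Lemma product_subl mu mu' nu : product_measure (mu \- mu') nu =
  product_measure mu nu \- product_measure mu' nu.
Proof.
apply/funext => F /=; have := product_combol 1 (-1) mu mu' nu F.
rewrite mul1r mulN1r => <-; congr product_measure.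
by apply/funext => f; rewrite mul1r mulN1r.
Qed.

Lemma product_subr mu nu nu' : radon R X mu -> radon R X nu -> radon R X nu' ->
  product_measure mu (nu \- nu') = product_measure mu nu \- product_measure mu nu'.
Proof.
move=> rm rn rn'; apply/funext => F /=.
have := product_combor hX 1 (-1) F rm rn rn'.
rewrite mul1r mulN1r => <-; congr product_measure.
by apply/funext => f; rewrite mul1r mulN1r.
Qed.

(** The difference of the two squares is (tau - mu) (x) tau + mu (x) (tau - mu), a sum of positive
    measures. Finiteness thus passes to mu even where k is negative. *)
Lemma pos_energy_le mu tau : radon_pos R X mu -> radon_pos R X (tau \- mu) ->
  pos_energy tau -> pos_energy mu.
Proof.
move=> pmu pd [pt It]; split => //.
apply: (lsc_integral_dom_fin hXX _ _ _ mk It); try exact: (product_pos hX lX).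
have rm := pos_radon pmu; have rt := pos_radon pt; have rd := pos_radon pd.
have p1 := product_pos hX lX pd pt; have p2 := product_pos hX lX pmu pd.
have := pos_add p1 p2; congr radon_pos; apply/funext => F.
by rewrite product_subl product_subr //=; lra.
Qed.

(* kappa(nu - tau, nu - tau) would be -oo otherwise. *)
Lemma mutual_energy_fin nu tau : pos_energy nu -> pos_energy tau ->
  (I nu tau < +oo)%E.
Proof.
move=> [pn In] [pt It].
have rn := pos_radon pn; have rt := pos_radon pt.
have pnn := product_pos hX lX pn pn; have ptt := product_pos hX lX pt pt.
have pnt := product_pos hX lX pn pt; have ptn := product_pos hX lX pt pn.
have rd := radon_sub rn rt.
have dE : product_measure (nu \- tau) (nu \- tau) =
    (product_measure nu nu \+ product_measure tau tau) \-
    (product_measure nu tau \+ product_measure tau nu).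
  by apply/funext => F; rewrite product_subl !product_subr //=; lra.
have [] := @signed_integral_split _ _ hXX lXX _ _ _ k
  (product_radon hX lX rd rd) (pos_add pnn ptt) (pos_add pnt ptn) dE mk.
  by rewrite lsc_integralD // lte_add_pinfty.
move=> idef iE; have := pk.2 _ rd idef; rewrite /energy iE.
rewrite !lsc_integralD //.
have := lsc_integral_gt (product_measure tau nu) mk; move: In It.
case: (I nu tau) => [a||]; rewrite ?ltry ?ltNye //.
by case: (I tau nu) => [b||] //; case: (I nu nu) => [c||] //;
  case: (I tau tau) => [d||].
Qed.

(** Both Jordan parts of nu (x) nu integrate k finitely, being minimal, hence so does their sum. By
    [abs_product] it dominates |nu| (x) |nu|, so |nu| has finite energy, and each part of nu lies
    below |nu|. *)
Lemma pos_energy_jordan nu : finite_energy k nu ->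
  pos_energy (jpos nu) /\ pos_energy (jneg nu).
Proof.
move=> fnu; have rnu : radon R X nu by case: fnu.
have [r [rP [P [N [a [b [[pP pN] PE Pa Nb rE]]]]]]] := iffLR (finite_energyP rnu) fnu.
have pj := jpos_pos hX lX rnu; have pn := jneg_pos hX lX rnu.
have Jp := jpos_pos hXX lXX rP; have Jn := jneg_pos hXX lXX rP.
have fJp : (lsc_integral (jpos (product_measure nu nu)) k < +oo)%E.
  apply: (lsc_integral_dom_fin hXX Jp pP _ mk); last by rewrite Pa ltry.
  exact: (jordan_min hXX lXX rP pP pN PE).
have fJn : (lsc_integral (jneg (product_measure nu nu)) k < +oo)%E.
  apply: (lsc_integral_dom_fin hXX Jn pN _ mk); last by rewrite Nb ltry.
  have := jordan_min hXX lXX rP pP pN PE; congr radon_pos.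
  apply/funext => F; have /= := congr1 (fun u => u F) (jordanE hXX lXX rP).
  by have /= := congr1 (fun u => u F) PE; lra.
have pm := pos_add pj pn.
have em : pos_energy (jpos nu \+ jneg nu).
  split => //; apply: (lsc_integral_dom_fin hXX _ (pos_add Jp Jn) _ mk).
  - exact: (product_pos hX lX).
  - exact: (abs_product hX lX rnu).
  - by rewrite lsc_integralD // lte_add_pinfty.
split; apply: (pos_energy_le _ _ em) => //.
  by have := pn; congr radon_pos; apply/funext => f /=; lra.
by have := pj; congr radon_pos; apply/funext => f /=; lra.
Qed.

Lemma mutual_integrates nu nu' tau tau' : pos_energy nu -> pos_energy nu' ->
  pos_energy tau -> pos_energy tau' ->
  integrates k (product_measure (nu \- nu') (tau \- tau'))
    (fine (I nu tau) + fine (I nu' tau') - (fine (I nu tau') + fine (I nu' tau))).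
Proof.
have If m m' : pos_energy m -> pos_energy m' -> I m m' = (fine (I m m'))%:E.
  move=> em em'; have := mutual_energy_fin em em'.
  by have := lsc_integral_gt (product_measure m m') mk; case: (I m m').
move=> en en' et et'.
have [pn pn'] : radon_pos R X nu /\ radon_pos R X nu' by case: en; case: en'.
have [pt pt'] : radon_pos R X tau /\ radon_pos R X tau' by case: et; case: et'.
have [rn rn'] := (pos_radon pn, pos_radon pn').
have [rt rt'] := (pos_radon pt, pos_radon pt').
split; first by apply: (product_radon hX lX); exact: radon_sub.
exists (product_measure nu tau \+ product_measure nu' tau'),
  (product_measure nu tau' \+ product_measure nu' tau),
  (fine (I nu tau) + fine (I nu' tau')), (fine (I nu tau') + fine (I nu' tau)).
split => //.
- by split; apply: pos_add; exact: (product_pos hX lX).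
- by apply/funext => F; rewrite product_subl !product_subr //=; lra.
- by rewrite lsc_integralD ?EFinD -?If //; exact: (product_pos hX lX).
- by rewrite lsc_integralD ?EFinD -?If //; exact: (product_pos hX lX).
Qed.

Lemma mutual_ex nu mu : finite_energy k nu -> finite_energy k mu ->
  exists r, integrates k (product_measure nu mu) r.
Proof.
move=> fn fm; have [ep en] := pos_energy_jordan fn.
have [ep' en'] := pos_energy_jordan fm.
have rn : radon R X nu by case: fn. have rm : radon R X mu by case: fm.
rewrite (jordanE hX lX rn) (jordanE hX lX rm).
by eexists; exact: mutual_integrates.
Qed.

Lemma energy_combo nu mu A C b1 b2 s t : radon R X nu -> radon R X mu ->
  integrates k (product_measure nu nu) A -> integrates k (product_measure mu mu) C ->
  integrates k (product_measure nu mu) b1 -> integrates k (product_measure mu nu) b2 ->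
  integrates k (product_measure (fun f => s * nu f + t * mu f)
                  (fun f => s * nu f + t * mu f))
    (s ^+ 2 * A + s * t * (b1 + b2) + t ^+ 2 * C).
Proof.
move=> rn rm iA iC i1 i2.
have := integrates_combo hXX s t mk (integrates_combo hXX s t mk iA i1)
  (integrates_combo hXX s t mk i2 iC).
rewrite (_ : s * _ + t * _ = s ^+ 2 * A + s * t * (b1 + b2) + t ^+ 2 * C); last by ring.
congr integrates; apply/funext => F.
by rewrite (product_combol) !(product_combor hX).
Qed.

Lemma finite_energy_combo nu mu s t : finite_energy k nu -> finite_energy k mu ->
  finite_energy k (fun f => s * nu f + t * mu f).
Proof.
move=> fn fm; have rn : radon R X nu by case: fn.
have rm : radon R X mu by case: fm.
have [A iA] := mutual_ex fn fn; have [C iC] := mutual_ex fm fm.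
have [b1 i1] := mutual_ex fn fm; have [b2 i2] := mutual_ex fm fn.
apply/finite_energyP; first exact: radon_combo.
by eexists; exact: energy_combo iA iC i1 i2.
Qed.

Lemma knorm2_combo nu mu : finite_energy k nu -> finite_energy k mu ->
  exists A B C, [/\ knorm2 k nu = A%:E, knorm2 k mu = C%:E, 0 <= A, 0 <= C &
  forall s t, knorm2 k (fun f => s * nu f + t * mu f) =
    (s ^+ 2 * A + s * t * B + t ^+ 2 * C)%:E].
Proof.
move=> fn fm; have rn : radon R X nu by case: fn.
have rm : radon R X mu by case: fm.
have [A iA] := mutual_ex fn fn; have [C iC] := mutual_ex fm fm.
have [b1 i1] := mutual_ex fn fm; have [b2 i2] := mutual_ex fm fn.
exists A, (b1 + b2), C; have kA := knorm2E iA; have kC := knorm2E iC.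
split => //.
- by rewrite -lee_fin -kA; apply: pk.2 => //; case: fn.
- by rewrite -lee_fin -kC; apply: pk.2 => //; case: fm.
- by move=> s t; apply: knorm2E; exact: energy_combo.
Qed.

Lemma knorm2_ge0 nu : finite_energy k nu -> (0 <= knorm2 k nu)%E.
Proof. by case=> rn idef _; exact: pk.2. Qed.

Lemma knorm_eq0 nu : finite_energy k nu -> knorm k nu = 0%E <-> knorm2 k nu = 0%E.
Proof.
move=> fn; have := knorm2_ge0 fn; case: (fn) => _ _.
rewrite /knorm /knorm2; case: (energy k nu nu) => [r||] //= _.
rewrite lee_fin => r0; split => [[/eqP]|[->]]; last by rewrite sqrtr0.
by rewrite sqrtr_eq0 => r0'; congr EFin; apply/eqP; rewrite eq_le r0' r0.
Qed.

Lemma finite_energyB nu mu : finite_energy k nu -> finite_energy k mu ->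
  finite_energy k (nu \- mu).
Proof.
move=> fn fm; have := finite_energy_combo 1 (-1) fn fm.
by congr finite_energy; apply/funext => f /=; rewrite mul1r mulN1r.
Qed.

(** The degenerate case of Cauchy-Schwarz: the energy of nu + t tau has no constant term in t, and a
    nonnegative polynomial t b + t^2 C forces b = 0. *)
Lemma zero_energy_orthogonal nu tau b1 b2 : finite_energy k nu ->
  finite_energy k tau -> knorm2 k nu = 0%E ->
  integrates k (product_measure nu tau) b1 ->
  integrates k (product_measure tau nu) b2 -> b1 + b2 = 0.
Proof.
move=> fn ft n0 i1 i2; have rn : radon R X nu by case: fn.
have rt : radon R X tau by case: ft.
have [A iA] := mutual_ex fn fn; have [C iC] := mutual_ex ft ft.
have {n0}A0 : A = 0 by move: n0; rewrite (knorm2E iA) => -[].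
have C0 : 0 <= C by rewrite -lee_fin -(knorm2E iC); exact: knorm2_ge0.
have H t : 0 <= t * (b1 + b2) + t ^+ 2 * C.
  have := knorm2_ge0 (finite_energy_combo 1 t fn ft).
  rewrite (knorm2E (energy_combo 1 t rn rt iA iC i1 i2)) lee_fin A0.
  by rewrite mulr0 add0r mul1r.
set b := b1 + b2 in H *.
(* Dividing by C + 1 remains legitimate for C = 0; the value there is - b^2 / (C + 1)^2. *)
have := H (- b / (C + 1)).
have C1 : 0 < C + 1 by lra.
have -> : - b / (C + 1) * b + (- b / (C + 1)) ^+ 2 * C =
  - (b ^+ 2 / (C + 1) ^+ 2) by field; lra.
rewrite oppr_ge0 => h; apply/eqP; rewrite -sqrf_eq0 eq_le sqr_ge0 andbT.
by move: h; rewrite pmulr_lle0 // invr_gt0 exprn_gt0.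
Qed.

(** By symmetry of k both mixed energies of rho - rho' and tau equal the same number. Their sum
    vanishes, hence so does that number, and Fubini rewrites it as a difference of integrals of
    potentials. *)
Lemma equivalent_potentials rho rho' tau : pos_energy rho -> pos_energy rho' ->
  pos_energy tau -> knorm2 k (rho \- rho') = 0%E ->
  lsc_integral tau (pot k rho) = lsc_integral tau (pot k rho').
Proof.
move=> er er' et n0; have [pr pr' pt] : [/\ radon_pos R X rho,
  radon_pos R X rho' & radon_pos R X tau] by case: er; case: er'; case: et.
have fr := iffRL (pos_energyP pr) er; have fr' := iffRL (pos_energyP pr') er'.
have ft := iffRL (pos_energyP pt) et.
have sk := lsc_integral_swap hX lX pk.1.
have If m : pos_energy m -> exists x, integrates k (product_measure m tau) x /\
    I tau m = x%:E /\ integrates k (product_measure tau m) x.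
  move=> em; have [pm _] := em; have := mutual_energy_fin em et.
  have pP := product_pos hX lX pm pt; have pP' := product_pos hX lX pt pm.
  have := lsc_integral_gt (product_measure m tau) mk.
  case E : (I m tau) => [x||] // _ _; exists x.
  have E' : I tau m = x%:E by rewrite sk.
  by split; [exact: (integrates_pos)|split => //; exact: (integrates_pos)].
have [x [i1 [ix i1']]] := If _ er; have [y [i2 [iy i2']]] := If _ er'.
rewrite -!(lsc_fubini hX lX lk mk) // ix iy; congr EFin.
have j1 : integrates k (product_measure (rho \- rho') tau) (1 * x + (-1) * y).
  have := integrates_combo hXX 1 (-1) mk i1 i2; congr integrates.
  by apply/funext => F; rewrite product_subl /=; lra.
have j2 : integrates k (product_measure tau (rho \- rho')) (1 * x + (-1) * y).
  have := integrates_combo hXX 1 (-1) mk i1' i2'; congr integrates.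
  apply/funext => F; rewrite product_subr //=; try exact: pos_radon; lra.
have := zero_energy_orthogonal (finite_energyB fr fr') ft n0 j1 j2.
by lra.
Qed.

Lemma pot_integral_fin rho tau : pos_energy rho -> pos_energy tau ->
  (lsc_integral tau (pot k rho) < +oo)%E.
Proof.
move=> er et; have [pr _] := er; have [pt _] := et.
by rewrite -(lsc_fubini hX lX lk mk) //; exact: mutual_energy_fin.
Qed.

End energy.

(** * Null sets and restriction to a closed set *)

Section null_sets.
Context {R : realType} {T : topologicalType} (hT : hausdorff_space T)
  (lT : locally_compact [set: T]).
Implicit Types (f h phi : T -> R) (H : T -> \bar R) (mu nu : (T -> R) -> R)
  (N E F : set T).

(** The outer measure of E is bounded by exhibiting a lower semicontinuous majorant of its
    indicator, so that unions are handled by adding witnesses instead of manipulating infima. *)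
Definition outer_le mu E (e : R) := exists H,
  [/\ lower_semicontinuous H, forall x, (0 <= H x)%E,
      forall x, E x -> (1 <= H x)%E & (lsc_integral mu H <= e%:E)%E].

Definition null mu E := forall e, 0 < e -> outer_le mu E e.

Lemma negligibleP mu E : radon_pos R T mu -> negligible_for mu E <-> null mu E.
Proof.
move=> pmu; rewrite /negligible_for /upper_integral; set S := [set _ | _ in _].
have ind x : E x -> (EFin \o \1_E) x = 1%E :> \bar R.
  by move=> Ex; rewrite /= indicE mem_set.
split=> [inf0 e e0|nE].
  have : (ereal_inf S < e%:E)%E by rewrite inf0 lte_fin.
  move=> /ereal_inf_lt[_ [H [lH HE] <-]] He; exists H; split => //; last exact: ltW.
    by move=> x; have [] := HE x.
  by move=> x /ind <-; have [] := HE x.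
apply/eqP; rewrite eq_le; apply/andP; split; last first.
  apply: le_ereal_inf_tmp => _ [H [lH HE] <-]; apply: (lsc_integral_ge0 hT pmu).
  by move=> x; have [] := HE x.
apply/lee_addgt0Pr => e e0; rewrite add0e; have [H [lH H0 H1 He]] := nE e e0.
apply: le_trans He; apply: ereal_inf_lbound; exists H => //; split => // x.
split => //=; rewrite indicE; have [xE|xE] := boolP (x \in E); last exact: H0.
by apply: H1; rewrite inE in xE.
Qed.

Lemma outer_leS mu E N e : E `<=` N -> outer_le mu N e -> outer_le mu E e.
Proof. by move=> EN [H [? ? h ?]]; exists H; split => // x /EN/h. Qed.

Lemma nullS mu E N : E `<=` N -> null mu N -> null mu E.
Proof. by move=> EN nN e e0; apply: outer_leS EN _; exact: nN. Qed.

Lemma lsc_add (H H' : T -> \bar R) : (forall x, 0 <= H x)%E ->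
  (forall x, 0 <= H' x)%E -> lower_semicontinuous H -> lower_semicontinuous H' ->
  lower_semicontinuous (fun x => H x + H' x)%E.
Proof.
move=> H0 H'0 lH lH' x r /lte_add_split[||s [t [sH tH' rst]]].
- exact: lt_le_trans (ltNyr 0) (H0 x).
- exact: lt_le_trans (ltNyr 0) (H'0 x).
have [V xV VH] := lH x s sH; have [W xW WH] := lH' x t tH'.
exists (V `&` W); first exact: filterI.
move=> y [/VH Vy /WH Wy]; apply: le_lt_trans (lteD Vy Wy).
by rewrite -EFinD lee_fin.
Qed.

Lemma outer_leU mu E N e d : radon_pos R T mu ->
  outer_le mu E e -> outer_le mu N d -> outer_le mu (E `|` N) (e + d).
Proof.
move=> pmu [H [lH H0 H1 He]] [H' [lH' H'0 H'1 He']].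
exists (fun x => H x + H' x)%E; split.
- exact: lsc_add.
- by move=> x; rewrite adde_ge0.
- move=> x [/H1|/H'1] h; rewrite -[1%E]adde0; [exact: leeD|].
  by rewrite addeC; exact: leeD.
- apply: le_trans (lsc_integral_addfun hT lT pmu lH lH' _ _) _;
    try exact: minorized_ge0.
  by rewrite EFinD leeD.
Qed.

Lemma nullU mu E N : radon_pos R T mu -> null mu E -> null mu N ->
  null mu (E `|` N).
Proof.
move=> pmu nE nN e e0; rewrite [e]splitr.
by apply: outer_leU => //; [apply: nE|apply: nN]; lra.
Qed.

(** The n-th set is covered at cost [e / 2 ^+ n.+1]; the first n covers together cost at most
    [e - e / 2 ^+ n], and monotone convergence passes to the supremum of the partial sums. *)
Lemma null_bigcup mu (E : nat -> set T) : radon_pos R T mu ->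
  (forall n, null mu (E n)) -> null mu (\bigcup_n E n).
Proof.
move=> pmu nE e e0.
have en n : 0 < e / 2 ^+ n.+1 by rewrite divr_gt0 // exprn_gt0.
pose H n := projT1 (cid (nE n _ (en n))).
have HP n : [/\ lower_semicontinuous (H n), forall x, (0 <= H n x)%E,
    forall x, E n x -> (1 <= H n x)%E &
    (lsc_integral mu (H n) <= (e / 2 ^+ n.+1)%:E)%E].
  exact: (projT2 (cid (nE n _ (en n)))).
pose fix S n : T -> \bar R :=
  if n is n'.+1 then fun x => (S n' x + H n' x)%E else fun=> 0%E.
have SP n : [/\ lower_semicontinuous (S n), forall x, (0 <= S n x)%E &
    (lsc_integral mu (S n) <= (e - e / 2 ^+ n)%:E)%E].
  elim: n => [|n [lS S0 Sn]] /=.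
    split => //.
      by move=> x r r0; exists setT => //; exact: filterT.
    rewrite expr0 divr1 subrr; apply: lsc_integral_le => f Cf f0.
    rewrite lee_fin -(radon0 hT (pos_radon pmu)); apply: (pos_le hT) => //.
    exact: Cc0.
  have [lH H0 _ Hn] := HP n; split.
  - exact: lsc_add.
  - by move=> x; rewrite adde_ge0.
  - apply: le_trans (lsc_integral_addfun hT lT pmu lS lH _ _) _;
      try exact: minorized_ge0.
    apply: le_trans (leeD Sn Hn) _; rewrite -EFinD lee_fin exprS invfM.
    by rewrite le_eqVlt; apply/orP; left; apply/eqP; field; rewrite expf_neq0.
have SH n x : (H n x <= S n.+1 x)%E.
  by rewrite /= -[leLHS]add0e leeD2r //; have [] := SP n.
exists (fun x => ereal_sup (range (S ^~ x))); split.
- move=> x r /ereal_sup_gt[_ [n _ <-] rS]; have [lS _ _] := SP n.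
  have [V xV VS] := lS x r rS; exists V => // y /VS h; apply: lt_le_trans h _.
  by apply: ereal_sup_ubound; exists n.
- by move=> x; apply: ereal_sup_ubound; exists 0%N.
- move=> x [n _ Ex]; have [_ _ /(_ x Ex) h _] := HP n.
  apply: (le_trans h); apply: (le_trans (SH n x)).
  by apply: ereal_sup_ubound; exists n.+1.
- apply: (lsc_integral_incr hT lT pmu (Fn := S)).
  + by move=> n; have [] := SP n.
  + by apply: minorized_ge0 => // x; have [] := SP 0%N.
  + by move=> n x /=; rewrite -[leLHS]adde0 leeD2l //; have [] := HP n.
  + by move=> x r /ereal_sup_gt[_ [n _ <-] rS]; exists n.
  + move=> n; have [_ _ Sn] := SP n; apply: (le_trans Sn).
    by rewrite lee_fin lerBlDr lerDl divr_ge0 ?(ltW e0) // exprn_ge0.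
Qed.

Lemma null_le mu nu E : radon_pos R T mu -> radon_pos R T nu ->
  radon_pos R T (nu \- mu) -> null nu E -> null mu E.
Proof.
move=> pmu pnu pd nE e e0; have [H [lH H0 H1 He]] := nE e e0.
exists H; split => //; apply: le_trans He.
rewrite (lsc_integral_le_measure hT pmu pnu pd); last exact: minorized_ge0.
by rewrite leeDl // (lsc_integral_ge0 hT).
Qed.

Lemma null_scale mu c E : 0 < c -> null mu E -> null (fun f => c * mu f) E.
Proof.
move=> c0 nE e e0; have [|H [lH H0 H1 He]] := nE (c^-1 * e).
  by rewrite mulr_gt0 // invr_gt0.
exists H; split => //; apply: lsc_integral_le => f Cf fH.
rewrite lee_fin -ler_pdivlMl // -lee_fin; apply: le_trans He.
exact: le_lsc_integral.
Qed.

Definition mass mu : \bar R := lsc_integral mu (cst 1%E).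

Lemma mass_approx mu e : (mass mu < +oo)%E -> radon_pos R T mu -> 0 < e ->
  exists f, [/\ Cc R T f, forall x, 0 <= f x <= 1 & (mass mu <= (mu f + e)%:E)%E].
Proof.
move=> mfin pmu e0; have : (-oo < mass mu)%E.
  by apply: lsc_integral_gt; apply: minorized_ge0.
case E : (mass mu) mfin => [M||] // _ _.
have : ((M - e)%:E < mass mu)%E by rewrite E lte_fin; lra.
move=> /lt_lsc_integral[f [Cf f1 Mf]]; have Cp := Cc_pos hT Cf.
exists f^\+; split => //.
  move=> x; rewrite funrpos_ge0 /= /funrpos ge_max ler01 andbT.
  by have := f1 x; rewrite lee_fin.
have : mu f <= mu f^\+ by apply: (pos_le hT) => // x; rewrite /funrpos le_max lexx.
by rewrite lee_fin; lra.
Qed.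

(** Finite mass is nearly exhausted by some f in [Cc] with values between 0 and 1. Off its compact
    support 1 - f equals 1 and has small integral, so only a compact piece of E is left. *)
Lemma locally_negligible_null mu E : radon_pos R T mu -> (mass mu < +oo)%E ->
  locally_negligible mu E -> null mu E.
Proof.
move=> pmu mfin lnE e e0; have [|f [Cf f01 fm]] := @mass_approx mu (e / 2) mfin pmu.
  by lra.
have [cf [K cK fK]] := iffLR (CcP hT f) Cf.
have /(negligibleP _ pmu) nEK := lnE K cK.
rewrite [e]splitr; apply: (@outer_leS _ _ ((E `&` K) `|` ~` K)).
  by move=> x Ex; have [Kx|nKx] := pselect (K x); [left|right].
apply: outer_leU => //; first by apply: nEK; lra.
exists (EFin \o (fun x => 1 - f x)); split.
- move=> x r /=; rewrite lte_fin => rx.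
  exists [set y | r < 1 - f y]; last by move=> y; rewrite /= lte_fin.
  apply: (@nbhs_gt _ _ (fun y => 1 - f y)) => //.
  apply: continuousDf; first exact: cst_continuous.
  exact: continuousNf.
- by move=> x /=; rewrite lee_fin; have /andP[] := f01 x; lra.
- by move=> x nKx /=; rewrite fK // subr0.
- apply: lsc_integral_le => h Ch hf.
  have : ((mu (fun x => h x + f x))%:E <= mass mu)%E.
    apply: le_lsc_integral; first exact: CcD.
    by move=> x; have := hf x; rewrite /= !lee_fin; lra.
  move=> /le_trans/(_ fm); rewrite (radonD (pos_radon pmu)) // !lee_fin.
  by lra.
Qed.

Lemma null_locally_negligible mu E : radon_pos R T mu -> null mu E ->
  locally_negligible mu E.
Proof.
by move=> pmu nE K _; apply/negligibleP => //; apply: nullS nE => x [].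
Qed.

Lemma null_setT mu : radon_pos R T mu -> null mu setT -> (mass mu <= 0)%E.
Proof.
move=> pmu nT; apply/lee_addgt0Pr => e /nT[H [lH H0 H1 He]]; rewrite add0e.
by apply: le_trans He; apply: lsc_integral_mono => x; exact: H1.
Qed.

Lemma lsc_indic_open E : open E -> lower_semicontinuous (EFin \o \1_E : T -> \bar R).
Proof.
move=> oE x r; have [xE|xE] /= := boolP (x \in E); rewrite indicE.
  rewrite xE => r1; rewrite inE in xE.
  exists E; first exact: open_nbhs_nbhs.
  by move=> y Ey /=; rewrite indicE mem_set.
rewrite (negbTE xE) => r0; exists setT; first exact: filterT.
by move=> y _ /=; apply: lt_le_trans r0 _; rewrite lee_fin indicE.
Qed.

Lemma indic_Cc_le E f : (forall x, ((f x)%:E <= (EFin \o \1_E) x)%E) ->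
  (forall x, f x <= 1) /\ forall x, ~ E x -> f x <= 0.
Proof.
move=> fE; split=> x => [|nE]; have := fE x; rewrite /= lee_fin indicE.
  by move=> h; apply: (le_trans h); case: (_ \in _).
by rewrite memNset.
Qed.

Lemma outer_le_open mu E e : open E ->
  (forall f, Cc R T f -> (forall x, f x <= 1) -> (forall x, ~ E x -> f x <= 0) ->
    mu f <= e) -> outer_le mu E e.
Proof.
move=> oE H; exists (EFin \o \1_E); split.
- exact: lsc_indic_open.
- by move=> x; rewrite /= lee_fin indicE.
- by move=> x Ex; rewrite /= lee_fin indicE mem_set.
- apply: lsc_integral_le => f Cf /indic_Cc_le[f1 f0].
  by rewrite lee_fin; exact: H.
Qed.

(** * Restriction of a positive measure to a closed set *)

Section restriction.
Variables (tau : (T -> R) -> R) (F : set T).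
Hypotheses (ptau : radon_pos R T tau) (cF : closed F).
Let rtau := pos_radon ptau.

Definition cutoff : set (T -> R) :=
  [set phi : T -> R | [/\ continuous phi, forall x, 0 <= phi x <= 1 &
                         forall x, F x -> phi x = 1]].

(** For f >= 0 in [Cc] this is the integral of f over F: since F is closed, the pointwise infimum of
    the cutoffs is its indicator. *)
Definition restr_cone f : R := inf [set tau (fun x => f x * phi x) | phi in cutoff].

Definition restriction : (T -> R) -> R :=
  on_Cc (fun f => restr_cone f^\+ - restr_cone f^\-).

Lemma cutoff1 : cutoff (fun=> 1).
Proof.
by split => //; [exact: cst_continuous|move=> x; rewrite ler01 lexx].
Qed.

Lemma restr_cone_lb f phi : (forall x, 0 <= f x) -> cutoff phi ->
  restr_cone f <= tau (fun x => f x * phi x).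
Proof.
move=> f0 cphi; apply: inf_lbound; last by exists phi.
exists 0 => _ [psi [_ psi0 _] <-]; apply: (pos_ge0 ptau) => x.
by rewrite mulr_ge0 //; have /andP[] := psi0 x.
Qed.

Lemma restr_cone_ge f c :
  (forall phi, cutoff phi -> c <= tau (fun x => f x * phi x)) -> c <= restr_cone f.
Proof.
move=> H; apply: lb_le_inf.
  by exists (tau (fun x => f x * 1)), (fun=> 1) => //; exact: cutoff1.
by move=> _ [phi cphi <-]; exact: H.
Qed.

(** For the upper bound, a cutoff good for f and one good for h are replaced by their minimum, again
    a cutoff. *)
Lemma restr_coneD f h : Cc R T f -> Cc R T h ->
  (forall x, 0 <= f x) -> (forall x, 0 <= h x) ->
  restr_cone (fun x => f x + h x) = restr_cone f + restr_cone h.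
Proof.
move=> Cf Ch f0 h0; have fh0 x : 0 <= f x + h x by rewrite addr_ge0.
apply/eqP; rewrite eq_le; apply/andP; split; last first.
  apply: restr_cone_ge => phi /[dup] cphi [cp _ _].
  rewrite (_ : (fun x => _) = fun x => f x * phi x + h x * phi x); last first.
    by apply/funext => x; rewrite mulrDl.
  rewrite (radonD rtau); [|exact: CcMr|exact: CcMr].
  by apply: lerD; exact: restr_cone_lb.
rewrite -lerBlDl; apply: restr_cone_ge => psi /[dup] cpsi [cq q01 q1].
rewrite lerBlDl -lerBlDr; apply: restr_cone_ge => phi /[dup] cphi [cp p01 p1].
rewrite lerBlDr -(radonD rtau); [|exact: CcMr|exact: CcMr].
have cm : cutoff (fun x => Num.min (phi x) (psi x)).
  split; first exact: continuous_minf.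
    move=> x; have /andP[a b] := p01 x; have /andP[c d] := q01 x.
    by rewrite le_min a c /= ge_min b.
  by move=> x Fx; rewrite p1 // q1 // minxx.
apply: le_trans (restr_cone_lb fh0 cm) _; apply: (pos_le hT) => //.
- by apply: (CcMr hT); [exact: CcD|case: cm].
- by apply: (CcD hT); exact: CcMr.
- move=> x; rewrite mulrDl; apply: lerD; apply: ler_wpM2l => //.
    by rewrite ge_min lexx.
  by rewrite ge_min lexx orbT.
Qed.

Lemma restr_coneZ c f : 0 <= c -> Cc R T f -> (forall x, 0 <= f x) ->
  restr_cone (fun x => c * f x) = c * restr_cone f.
Proof.
move=> c0 Cf f0.
have E phi : cutoff phi ->
    tau (fun x => c * f x * phi x) = c * tau (fun x => f x * phi x).
  move=> [cp _ _]; rewrite -(radonZ hT c rtau (CcMr hT Cf cp)).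
  by congr tau; apply/funext => x; rewrite mulrA.
have [->|cn0] := eqVneq c 0.
  rewrite mul0r; apply/eqP; rewrite eq_le; apply/andP; split.
    apply: le_trans (restr_cone_lb _ cutoff1) _; first by move=> x; rewrite mul0r.
    rewrite (_ : (fun x => _) = fun=> 0) ?(radon0 hT rtau) //.
    by apply/funext => x; rewrite !mul0r.
  apply: restr_cone_ge => phi cphi; rewrite (_ : (fun x => _) = fun=> 0).
    by rewrite (radon0 hT rtau).
  by apply/funext => x; rewrite !mul0r.
have {}c0 : 0 < c by rewrite lt_neqAle eq_sym cn0.
apply/eqP; rewrite eq_le; apply/andP; split.
  rewrite -ler_pdivrMl //; apply: restr_cone_ge => phi cphi.
  rewrite ler_pdivrMl // -E //; apply: restr_cone_lb => // x.
  by rewrite mulr_ge0 // ltW.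
apply: restr_cone_ge => phi cphi; rewrite E // ler_pM2l //.
exact: restr_cone_lb.
Qed.

Lemma restr_cone_ge0 f : Cc R T f -> (forall x, 0 <= f x) -> 0 <= restr_cone f.
Proof.
move=> Cf f0; apply: restr_cone_ge => phi [_ p01 _]; apply: (pos_ge0 ptau) => x.
by rewrite mulr_ge0 //; have /andP[] := p01 x.
Qed.

Lemma restriction_pos : radon_pos R T restriction.
Proof.
apply: (cone_ext_pos hT lT); [exact: restr_coneD|exact: restr_coneZ|exact: restr_cone_ge0].
Qed.

Lemma restrictionE f : Cc R T f -> (forall x, 0 <= f x) ->
  restriction f = restr_cone f.
Proof. by apply: (cone_extE hT); [exact: restr_coneD|exact: restr_coneZ]. Qed.

Lemma restriction_le : radon_pos R T (tau \- restriction).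
Proof.
split; first by apply: radon_sub => //; exact: pos_radon restriction_pos.
move=> f Cf f0 /=; rewrite subr_ge0 restrictionE //.
apply: le_trans (restr_cone_lb f0 cutoff1) _.
by rewrite (_ : (fun x => _) = f) //; apply/funext => x; rewrite mulr1.
Qed.

(* Use the cutoff functions max(0, 1 - f / e). *)
Lemma restriction_off f : Cc R T f -> (forall x, F x -> f x <= 0) ->
  restriction f <= 0.
Proof.
move=> Cf fF; have pr := restriction_pos; have Cp := Cc_pos hT Cf.
have f0 x : 0 <= f^\+ x by exact: funrpos_ge0.
apply: (@le_trans _ _ (restriction f^\+)).
  by apply: (pos_le hT) => // x; rewrite /funrpos le_max lexx.
rewrite restrictionE //.
have [_ [K cK fK]] := iffLR (CcP hT _) Cp.
have [w [Cw w0 w1]] := @Cc_ge1 R T hT lT _ cK.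
have tw : 0 <= tau w by exact: pos_ge0.
suff H e : 0 < e -> restr_cone f^\+ <= e * tau w.
  rewrite leNgt; apply/negP => J0.
  pose q := restr_cone f^\+ / (tau w + 1).
  have q0 : 0 < q by apply: divr_gt0; lra.
  have qE : q * (tau w + 1) = restr_cone f^\+ by rewrite divfK //; lra.
  by have := H _ q0; lra.
move=> e0; pose phi x := Num.max 0 (1 - e^-1 * f^\+ x).
have cphi : cutoff phi.
  split.
  - apply: continuous_maxf; first exact: cst_continuous.
    apply: continuousDf; first exact: cst_continuous.
    by apply: continuousNf; apply: continuousZf; exact: Cc_cont.
  - move=> x; rewrite le_max lexx /= ge_max ler01 /= gerBl mulr_ge0 //.
    by rewrite invr_ge0 ltW.
  - move=> x Fx; have -> : phi x = Num.max 0 (1 - e^-1 * 0).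
      by rewrite /phi /funrpos (max_idPr (fF x Fx)).
    by rewrite mulr0 subr0; apply/max_idPr.
apply: le_trans (restr_cone_lb f0 cphi) _; rewrite -(radonZ hT e rtau Cw).
apply: (pos_le hT) => //; [by apply: CcMr => //; case: cphi|exact: CcZ|].
move=> x; have [Kx|nKx] := pselect (K x); last by rewrite fK // mul0r mulr_ge0 // ltW.
apply: (@le_trans _ _ e); last by rewrite ler_peMr ?w1 // ltW.
rewrite /phi; have [h|h] := leP (1 - e^-1 * f^\+ x) 0.
  by rewrite mulr0 ltW.
have fe : f^\+ x < e by move: h; rewrite subr_gt0 ltr_pdivrMl // mulr1.
apply: (@le_trans _ _ (f^\+ x)); last exact: ltW.
rewrite -[leRHS]mulr1; apply: ler_wpM2l => //.
by rewrite gerBl mulr_ge0 // invr_ge0 ltW.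
Qed.

Lemma restriction_null : null restriction (~` F).
Proof.
move=> e e0; apply: outer_le_open; first by rewrite openC.
move=> f Cf _ f0; apply: le_trans (ltW e0); apply: restriction_off => // x Fx.
by apply: f0 => /(_ Fx).
Qed.

Lemma restriction_le_on f h : Cc R T f -> Cc R T h ->
  (forall x, F x -> f x <= h x) -> restriction f <= restriction h.
Proof.
move=> Cf Ch fh; have rr := pos_radon restriction_pos.
rewrite -subr_le0 -(radonB hT rr) //; apply: restriction_off; first exact: CcB.
by move=> x Fx; rewrite subr_le0 fh.
Qed.

(** Take f nearly exhausting the mass and a cutoff phi with [tau (f * phi)] small. Then f phi + (1 -
    f) is nonnegative, equals 1 on F and has small integral. *)
Lemma restriction0_null : (mass tau < +oo)%E ->
  (forall f, Cc R T f -> (forall x, 0 <= f x) -> restriction f = 0) -> null tau F.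
Proof.
move=> mfin r0 e e0; have [|f [Cf f01 fm]] := @mass_approx tau (e / 2) mfin ptau.
  by lra.
have f0 x : 0 <= f x by have /andP[] := f01 x.
have [phi cphi fphi] : exists2 phi, cutoff phi & tau (fun x => f x * phi x) < e / 2.
  apply: contrapT => H; have := r0 f Cf f0; rewrite restrictionE // => J0.
  suff : e / 2 <= restr_cone f by rewrite J0; lra.
  apply: restr_cone_ge => phi cphi; rewrite leNgt; apply/negP => h.
  by apply: H; exists phi.
have [cp p01 p1] := cphi; have Cfp := CcMr hT Cf cp.
exists (EFin \o (fun x => f x * phi x + (1 - f x))); split.
- move=> x r /=; rewrite lte_fin => rx.
  exists [set y | r < f y * phi y + (1 - f y)]; last by move=> y; rewrite /= lte_fin.
  apply: (@nbhs_gt _ _ (fun y => f y * phi y + (1 - f y))) => //.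
  apply: continuousDf; first exact: (Cc_cont Cfp).
  apply: continuousDf; first exact: cst_continuous.
  exact: continuousNf (Cc_cont Cf).
- move=> x /=; rewrite lee_fin; have /andP[_ f1] := f01 x; have /andP[q0 _] := p01 x.
  by have := mulr_ge0 (f0 x) q0; lra.
- by move=> x Fx /=; rewrite p1 // lee_fin; lra.
- apply: lsc_integral_le => h Ch hf.
  have : ((tau (fun x => (h x - f x * phi x) + f x))%:E <= mass tau)%E.
    apply: le_lsc_integral; first by apply: (CcD hT) => //; exact: CcB.
    by move=> x; have := hf x; rewrite /= !lee_fin; lra.
  move=> /le_trans/(_ fm); rewrite (radonD rtau) //; last exact: CcB.
  by rewrite (radonB hT rtau) // !lee_fin; lra.
Qed.

End restriction.

(** Chebyshev's inequality for a minorant f whose integral is within [eta * e] of that of u: a test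
    function h for the open set where u > f + eta satisfies f + eta h <= u, whence [mu h <= e]. *)
Lemma quasi_continuous mu (u : T -> \bar R) eta e : radon_pos R T mu ->
  lower_semicontinuous u -> minorized u -> (lsc_integral mu u < +oo)%E ->
  0 < eta -> 0 < e -> exists f, [/\ Cc R T f, forall x, ((f x)%:E <= u x)%E,
    open [set x | ((f x + eta)%:E < u x)%E] &
    outer_le mu [set x | ((f x + eta)%:E < u x)%E] e].
Proof.
move=> pmu lu mu_ ufin eta0 e0; have := lsc_integral_gt mu mu_.
case E : (lsc_integral mu u) ufin => [U||] // _ _.
have : ((U - eta * e)%:E < lsc_integral mu u)%E.
  by rewrite E lte_fin; have := mulr_gt0 eta0 e0; lra.
move=> /lt_lsc_integral[f [Cf fu Uf]]; exists f.
have oG : open [set x | ((f x + eta)%:E < u x)%E].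
  rewrite openE => x /= xG.
  have [q fq qu] : exists2 q, f x + eta < q & (q%:E < u x)%E.
    case: (u x) xG => [a||] //.
      by rewrite lte_fin => h; exists ((f x + eta + a) / 2); rewrite ?lte_fin; lra.
    by move=> _; exists (f x + eta + 1); rewrite ?ltry //; lra.
  have [V xV Vu] := lu x q qu.
  have cNf : continuous (fun y => - f y) by apply: continuousNf; exact: Cc_cont.
  have xW : nbhs x (V `&` [set y | eta - q < - f y]).
    by apply: filterI => //; apply: (nbhs_gt cNf); lra.
  apply: filterS xW => y [/Vu Vy /= fy]; apply: lt_trans Vy; rewrite lte_fin; lra.
split => //; apply: outer_le_open => // h Ch h1 h0.
have Ceh := CcZ hT eta Ch; have rmu := pos_radon pmu.
have : ((mu (fun x => eta * h x + f x))%:E <= lsc_integral mu u)%E.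
  apply: le_lsc_integral; first exact: CcD.
  move=> x; have [xG|xG] := pselect ([set x | ((f x + eta)%:E < u x)%E] x).
    apply/ltW; apply: le_lt_trans xG; rewrite lee_fin.
    by have := ler_wpM2l (ltW eta0) (h1 x); lra.
  apply: le_trans (fu x); rewrite lee_fin.
  by have := ler_wpM2l (ltW eta0) (h0 x xG); lra.
rewrite E lee_fin (radon_lin eta rmu) // => h2.
by rewrite -(ler_pM2l eta0); lra.
Qed.

(* Off open sets of small measure the lower semicontinuous functions u and v are
   uniform limits of continuous functions, so that the set where u + d <= v + c
   is exhausted by closed sets up to small measure. *)
Lemma null_lt mu (u v : T -> \bar R) (c : T -> R) : radon_pos R T mu ->
  (mass mu < +oo)%E -> lower_semicontinuous u -> lower_semicontinuous v ->
  minorized u -> minorized v ->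
  (lsc_integral mu u < +oo)%E -> (lsc_integral mu v < +oo)%E -> continuous c ->
  (forall F d, closed F -> 0 < d -> (forall x, F x ->
     [/\ u x < +oo, v x < +oo & u x + d%:E <= v x + (c x)%:E]%E) ->
     forall f, Cc R T f -> (forall x, 0 <= f x) -> restriction mu F f = 0) ->
  null mu [set x | u x = +oo \/ v x = +oo \/ u x < v x + (c x)%:E]%E.
Proof.
move=> pmu mfin lu lv mu_ mv ufin vfin cc H.
pose E d := [set x | u x = +oo \/ v x = +oo \/ u x + d%:E <= v x + (c x)%:E]%E.
have nE d : 0 < d -> null mu (E d).
  move=> d0 e e0; have e3 : 0 < e / 3 by lra.
  have d4 : 0 < d / 4 by lra.
  have [f [Cf fu oG Ge]] := quasi_continuous pmu lu mu_ ufin d4 e3.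
  have [h [Ch hv oG' Ge']] := quasi_continuous pmu lv mv vfin d4 e3.
  set G := [set x | _] in oG Ge; set G' := [set x | _] in oG' Ge'.
  (* Off G and G' the functions u, v exceed f, h by at most d/4. Hence u + d <= v + c implies
     membership in F, while on F a margin d/4 survives for u and v themselves. *)
  pose F := [set x | f x + d / 2 <= h x + c x] `&` (~` G `&` ~` G').
  have cF : closed F.
    apply: closedI; last by apply: closedI; exact: open_closedC.
    have -> : [set x | f x + d / 2 <= h x + c x] =
        ~` [set x | 0 < f x + d / 2 - (h x + c x)].
      apply/seteqP; split => x /=; first by move=> ?; apply/negP; rewrite -leNgt; lra.
      by move=> /negP; rewrite -leNgt; lra.
    apply: open_closedC; rewrite openE => x /= x0.
    apply: (@nbhs_gt _ _ (fun x => f x + d / 2 - (h x + c x))) => //.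
    apply: continuousDf.
      by apply: continuousDf; [exact: Cc_cont Cf|exact: cst_continuous].
    by apply: continuousNf; apply: continuousDf => //; exact: Cc_cont Ch.
  have bnd x : ~ G x -> ~ G' x -> exists a b, [/\ u x = a%:E, v x = b%:E,
      f x <= a <= f x + d / 4 & h x <= b <= h x + d / 4].
    move=> /negP; rewrite /G /= -leNgt => ux /negP; rewrite /G' /= -leNgt => vx.
    move: (fu x) (hv x) ux vx; case: (u x) => [a||] //; case: (v x) => [b||] //.
    by rewrite !lee_fin => *; exists a, b; split => //; apply/andP.
  have nF : null mu F.
    apply: (restriction0_null pmu mfin); apply: (H F (d / 4)) => //.
    move=> x [/= fh [nG nG']]; have [a [b [-> -> /andP[a1 a2] /andP[b1 b2]]]] := bnd x nG nG'.
    by rewrite !ltry -!EFinD lee_fin; split => //; lra.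
  apply: (@outer_leS _ _ (F `|` (G `|` G'))).
    move=> x Ex; have [?|nG] := pselect (G x); first by right; left.
    have [?|nG'] := pselect (G' x); first by right; right.
    left; split => //=; have [a [b [ua vb /andP[a1 a2] /andP[b1 b2]]]] := bnd x nG nG'.
    by move: Ex; rewrite /E /= ua vb => -[//|[//|]]; rewrite -!EFinD lee_fin; lra.
  rewrite (_ : e = e / 3 + (e / 3 + e / 3)); last by lra.
  apply: outer_leU => //; first exact: nF.
  exact: outer_leU.
(* A strict inequality between finite values holds with some margin 1/(n+1). *)
apply: (@nullS _ _ (\bigcup_n E n.+1%:R^-1)); last first.
  by apply: null_bigcup => // n; apply: nE; rewrite invr_gt0.
move=> x /= [ux|[vx|uv]]; [by exists 0%N => //; left|by exists 0%N => //; right; left|].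
case Eu : (u x) uv => [a||]; case Ev : (v x) => [b||] // uv;
  try (by exists 0%N => //; left); try (by exists 0%N => //; right; left);
  try (by have := minorized_gt x mu_; rewrite Eu);
  try (by have := minorized_gt x mv; rewrite Ev).
move: uv; rewrite -EFinD lte_fin => /ltr_add_invr[n nab].
by exists n => //; right; right; rewrite Eu Ev -!EFinD lee_fin ltW.
Qed.

End null_sets.

(** * Relations holding nearly everywhere *)

(** An inequality on F alone suffices, since the restriction does not charge the complement. Raise v
    to +oo off the closed set F: the result is the supremum of the [Cc] functions dominated on F by
    a minorant of v, and on these the restriction compares by values on F only. *)
Lemma restriction_le_lsc (R : realType) (T : topologicalType)
    (hT : hausdorff_space T) (lT : locally_compact [set: T])
    (tau : (T -> R) -> R) (F : set T) (v : T -> \bar R) f :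
  radon_pos R T tau -> closed F -> lower_semicontinuous v -> minorized v ->
  Cc R T f -> (forall x, F x -> ((f x)%:E <= v x)%E) ->
  ((restriction tau F f)%:E <= lsc_integral (restriction tau F) v)%E.
Proof.
move=> pt cF lv mv Cf fv; have [f0 Cf0 f0v] := mv.
have pr := restriction_pos hT lT F pt.
pose w x : \bar R := if `[< F x >] then v x else +oo%E.
apply: (@le_trans _ _ (lsc_integral (restriction tau F) w)).
  apply: le_lsc_integral => // x; rewrite /w; case: asboolP => [/fv//|_].
  exact: leey.
apply: (@lsc_integral_dini _ _ hT lT _ _ [set h | Cc R T h /\ exists2 h1,
  Cc R T h1 /\ (forall x, ((h1 x)%:E <= v x)%E) & forall x, F x -> h x <= h1 x]
  f0) => //.
- by move=> h [].
- by split => //; exists f0.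
- move=> h h' [Ch [h1 [Ch1 h1v] hh1]] [Ch' [h1' [Ch1' h1v'] hh1']].
  exists (fun x => Num.max (h x) (h' x)); split.
  + split; first exact: Cc_max.
    exists (fun x => Num.max (h1 x) (h1' x)).
      by split; [exact: Cc_max|move=> x; rewrite EFin_max ge_max h1v h1v'].
    by move=> x Fx; rewrite ge_max !le_max hh1 // hh1' // orbT.
  + by move=> x; rewrite le_max lexx.
  + by move=> x; rewrite le_max lexx orbT.
- move=> x r; rewrite /w; case: asboolP => [Fx|nFx].
    move=> /(lsc_sup_Cc hT lT lv mv)[h [Ch hv rh]].
    by exists h => //; split => //; exists h.
  move=> _; have xV : nbhs x (~` F).
    by apply: open_nbhs_nbhs; split => //; rewrite openC.
  have [p [Cp p01 px pF]] := Cc_bump (R := R) hT lT xV.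
  pose n := `|r - f0 x| + 1.
  exists (fun y => f0 y + n * p y); last first.
    by rewrite px mulr1 /n; have := ler_norm (r - f0 x); lra.
  split; first by apply: (CcD hT) => //; exact: CcZ.
  by exists f0 => // y Fy; rewrite pF ?mulr0 ?addr0.
- move=> h [Ch [h1 [Ch1 h1v] hh1]].
  apply: (@le_trans _ _ (restriction tau F h1)%:E); last exact: le_lsc_integral.
  by rewrite lee_fin; exact: (restriction_le_on hT lT).
Qed.

Section nearly_everywhere.
Context {R : realType} {X : topologicalType} (hX : hausdorff_space X)
  (lX : locally_compact [set: X]).
Variable k : X * X -> \bar R.
Hypotheses (kk : energy_kernel k) (pk : positive_definite k).
Implicit Types (mu nu tau rho : (X -> R) -> R) (E : set X) (P : X -> Prop).

Let mk : minorized k := kernel_minorized hX kk.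
Let lk : lower_semicontinuous k. Proof. by case: kk. Qed.

(** Admissible measures have finite energy, so the inverse of the infimum is 0 only when the infimum
    is +oo, that is, when no unit measure is admissible. *)
Lemma nearly_everywhereP E P : nearly_everywhere k E P <->
  forall tau, finite_energy_on k [set x | E x /\ ~ P x] tau -> mass tau <> 1%E.
Proof.
rewrite /nearly_everywhere /interior_capacity /inf_energy.
set N := [set x | _]; split=> [cap0 tau tN t1|H].
  have : (knorm2 k tau < +oo)%E.
    case: tN => _ [_ _]; rewrite /knorm2; case: (energy k tau tau) => // r _.
    exact: ltry.
  set S := [set _ | _ in _] in cap0.
  have : (ereal_inf S <= knorm2 k tau)%E by apply: ereal_inf_lbound; exists tau.
  by move: cap0 => /eqP; rewrite inve_eq0 => /eqP ->; rewrite leye_eq => /eqP ->.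
set S := [set _ | _ in _]; have -> : S = set0.
  by rewrite -subset0 => x [tau [tN /(H tau tN)]].
by rewrite ereal_inf0 invey.
Qed.

(** A nonzero restriction, divided by its mass, would be a unit measure of finite energy on the
    exceptional set: it does not charge the complement of the closed set F, nor that of E, because
    it lies below tau. *)
Lemma nearly_everywhere_restriction E P tau F f : nearly_everywhere k E P ->
  pos_energy k tau -> (mass tau < +oo)%E -> null tau (~` E) -> closed F ->
  (forall x, F x -> E x -> ~ P x) ->
  Cc R X f -> (forall x, 0 <= f x) -> restriction tau F f = 0.
Proof.
move=> /nearly_everywhereP ne et mfin tE cF FP Cf f0; have [pt _] := et.
have pr := restriction_pos hX lX F pt.
have pd := restriction_le hX lX F pt.
have er := pos_energy_le hX lX kk pr pd et.
have m1 : minorized (cst 1%E : X -> \bar R) by exact: minorized_ge0.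
have := lsc_integral_dom_fin hX pr pt pd m1 mfin.
have := lsc_integral_gt (restriction tau F) m1.
case Em : (lsc_integral _ _) => [M||] // _ _.
have M0 : 0 <= M.
  by rewrite -lee_fin -Em; apply: lsc_integral_ge0.
(* Zero mass kills every bounded f, as [f / (b + 1)] lies below 1. *)
have [Mz|Mz] := eqVneq M 0.
  have [b b0 fb] := Cc_bounded hX Cf; have b1 : 0 < b + 1 by lra.
  apply/eqP; rewrite eq_le (pos_ge0 pr) // andbT.
  have : ((restriction tau F (fun x => (b + 1)^-1 * f x))%:E <= 0%:E)%E.
    rewrite -Mz -Em; apply: le_lsc_integral; first exact: CcZ.
    move=> x; rewrite lee_fin ler_pdivrMl // mulr1.
    by have := fb x; have := ler_norm (f x); lra.
  rewrite (radonZ hX _ (pos_radon pr) Cf) lee_fin pmulr_rle0 // invr_gt0.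
  exact: b1.
have {}M0 : 0 < M by rewrite lt_neqAle eq_sym Mz.
exfalso; apply: (ne (fun f => M^-1 * restriction tau F f)).
  have ps : radon_pos R X (fun f => M^-1 * restriction tau F f).
    by apply: pos_scale => //; rewrite invr_ge0 ltW.
  split; last first.
    have fr := iffRL (pos_energyP hX lX kk pr) er.
    have := finite_energy_combo hX lX kk pk M^-1 0 fr fr.
    by congr finite_energy; apply/funext => h; rewrite mul0r addr0.
  split => //; apply: (null_locally_negligible hX) => //.
  apply: null_scale; first by rewrite invr_gt0.
  apply: (@nullS _ _ _ _ (~` E `|` ~` F)).
    move=> x /= nx; have [Fx|] := pselect (F x); last by right.
    by left => Ex; apply: nx; split => //; exact: FP.
  apply: (nullU hX lX) => //; last exact: (restriction_null hX lX).
  exact: (null_le hX pr pt).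
rewrite /mass (lsc_integralZ _ pr m1 Em); last by rewrite invr_ge0 ltW.
by rewrite mulVf.
Qed.

(** For a unit measure on the exceptional set, local negligibility of the complement becomes nullity
    because the mass is finite; a null whole space would then force mass 0. *)
Lemma nearly_everywhereI E P :
  (forall tau, pos_energy k tau -> (mass tau < +oo)%E ->
     null tau (~` [set x | E x /\ ~ P x]) -> null tau setT) ->
  nearly_everywhere k E P.
Proof.
move=> H; apply/nearly_everywhereP => tau [[pt lnt] ft] m1.
have et := iffLR (pos_energyP hX lX kk pt) ft.
have mfin : (mass tau < +oo)%E by rewrite m1 ltry.
have := null_setT pt (H tau et mfin (locally_negligible_null hX lX pt mfin lnt)).
by rewrite m1 lee_fin ler10.
Qed.

Definition pot_ge nu (t c : R) (x : X) :=
  potential_def k nu x /\ (t%:E * potential k nu x >= c%:E)%E.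

Lemma pot_geP nu t c x r : integrates (fun y => k (x, y)) nu r ->
  pot_ge nu t c x <-> c <= t * r.
Proof.
move=> /(integratesP hX lX (minorized_sec hX mk x))[nud nue].
rewrite /pot_ge /potential nue -EFinM lee_fin.
by split=> [[]//|?]; split.
Qed.

(** Stronger than the potential being defined, which requires only one finite part; linear
    combinations of potentials need both. *)
Definition pot_finite nu x :=
  (pot k (jpos nu) x < +oo)%E /\ (pot k (jneg nu) x < +oo)%E.

Lemma pot_fin_num mu x : (pot k mu x < +oo)%E -> pot k mu x = (fine (pot k mu x))%:E.
Proof.
have := lsc_integral_gt mu (minorized_sec hX mk x); rewrite /pot.
by case: (lsc_integral _ _).
Qed.

Lemma pot_integrates nu x : radon R X nu -> pot_finite nu x ->
  integrates (fun y => k (x, y)) nu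
    (fine (pot k (jpos nu) x) - fine (pot k (jneg nu) x)).
Proof.
move=> rnu [/pot_fin_num up /pot_fin_num un]; split => //.
exists (jpos nu), (jneg nu), (fine (pot k (jpos nu) x)), (fine (pot k (jneg nu) x)).
split => //; last exact: (jordanE hX lX).
by split; [exact: (jpos_pos hX lX)|exact: (jneg_pos hX lX)].
Qed.

Lemma null_pot_lt tau rho rho' (c : X -> R) : pos_energy k tau ->
  pos_energy k rho -> pos_energy k rho' -> (mass tau < +oo)%E -> continuous c ->
  (forall F d, closed F -> 0 < d -> (forall x, F x ->
     [/\ pot k rho x < +oo, pot k rho' x < +oo &
         pot k rho x + d%:E <= pot k rho' x + (c x)%:E]%E) ->
     forall f, Cc R X f -> (forall x, 0 <= f x) -> restriction tau F f = 0) ->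
  null tau [set x | pot k rho x = +oo \/ pot k rho' x = +oo \/
                    pot k rho x < pot k rho' x + (c x)%:E]%E.
Proof.
move=> et er er' mfin cc H.
have [[pt _] [pr _] [pr' _]] := And3 et er er'.
apply: (null_lt hX lX pt mfin) => //.
- exact: (pot_lsc hX lX lk mk).
- exact: (pot_lsc hX lX lk mk).
- exact: (pot_minorized hX mk).
- exact: (pot_minorized hX mk).
- exact: (pot_integral_fin hX lX kk pk).
- exact: (pot_integral_fin hX lX kk pk).
Qed.

(** With p, n the potentials of the two parts, the relation fails where p < n + c/t if t > 0, and
    where n < p - c/t if t < 0. Each is a strict inequality between potentials of positive measures,
    so closed subsets detect its nullity. *)
Lemma null_not_pot_ge E nu t (c : X -> R) tau : t != 0 -> continuous c ->
  finite_energy k nu -> nearly_everywhere k E (fun x => pot_ge nu t (c x) x) ->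
  pos_energy k tau -> (mass tau < +oo)%E -> null tau (~` E) ->
  null tau [set x | ~ (pot_finite nu x /\ pot_ge nu t (c x) x)].
Proof.
move=> t0 cc fnu ne et mfin tE; have rnu : radon R X nu by case: fnu.
have [ep en] := pos_energy_jordan hX lX kk fnu.
have ct (s : R) : continuous (fun x => s * (c x / t)).
  apply: continuousZf; apply: continuousMf => //; exact: cst_continuous.
have finE x : pot_finite nu x -> exists p n,
    [/\ pot k (jpos nu) x = p%:E, pot k (jneg nu) x = n%:E &
        pot_ge nu t (c x) x <-> c x <= t * (p - n)].
  move=> fx; exists (fine (pot k (jpos nu) x)), (fine (pot k (jneg nu) x)).
  by have [/pot_fin_num ? /pot_fin_num ?] := fx; split => //;
    apply: pot_geP; exact: pot_integrates.
have cE x : c x = t * (c x / t) by rewrite mulrC divfK.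
have notfin x : ~ pot_finite nu x ->
    pot k (jpos nu) x = +oo%E \/ pot k (jneg nu) x = +oo%E.
  move=> nf; have [/eqP|up] := eqVneq (pot k (jpos nu) x) +oo%E; first by left; apply/eqP.
  have [/eqP|un] := eqVneq (pot k (jneg nu) x) +oo%E; first by right; apply/eqP.
  by exfalso; apply: nf; split; rewrite ltey.
have [tneg|tpos] := orP (etrans (esym (neq_lt t 0)) t0).
- apply: (nullS _ (null_pot_lt et en ep mfin (ct (-1)) _)); last first.
    move=> F d cF d0 HF f Cf f0.
    apply: (nearly_everywhere_restriction ne et mfin tE cF) => // x Fx _.
    have [un up] := HF x Fx; have [p [n [pE nE ->]]] := finE x (conj up un).
    rewrite pE nE -!EFinD lee_fin => h; apply/negP; rewrite -ltNge.
    by rewrite [ltRHS]cE ltr_nM2l //; lra.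
  move=> x /= nx; have [fx|/notfin[]] := pselect (pot_finite nu x); last 2 first.
  + by right; left.
  + by left.
  right; right; have [p [n [pE nE gE]]] := finE x fx.
  rewrite pE nE -EFinD lte_fin; have : ~ (c x <= t * (p - n)).
    by move=> /gE ?; apply: nx.
  move=> /negP; rewrite -ltNge [ltRHS]cE ltr_nM2l //; lra.
- apply: (nullS _ (null_pot_lt et ep en mfin (ct 1) _)); last first.
    move=> F d cF d0 HF f Cf f0.
    apply: (nearly_everywhere_restriction ne et mfin tE cF) => // x Fx _.
    have [up un] := HF x Fx; have [p [n [pE nE ->]]] := finE x (conj up un).
    rewrite pE nE -!EFinD lee_fin mul1r => h; apply/negP; rewrite -ltNge.
    by rewrite [ltRHS]cE ltr_pM2l //; lra.
  move=> x /= nx; have [fx|/notfin[]] := pselect (pot_finite nu x); last 2 first.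
  + by left.
  + by right; left.
  right; right; have [p [n [pE nE gE]]] := finE x fx.
  rewrite pE nE -EFinD lte_fin mul1r; have : ~ (c x <= t * (p - n)).
    by move=> /gE ?; apply: nx.
  move=> /negP; rewrite -ltNge [ltRHS]cE ltr_pM2l //; lra.
Qed.

(** This replaces the missing subadditivity of capacity: for a test measure on the exceptional set
    both given relations hold almost everywhere, hence so does their combination. *)
Lemma nearly_everywhere_combo E nu mu s r t (c d : X -> R) : t != 0 ->
  0 <= s -> 0 <= r -> continuous c -> continuous d ->
  finite_energy k nu -> finite_energy k mu ->
  nearly_everywhere k E (fun x => pot_ge nu t (c x) x) ->
  nearly_everywhere k E (fun x => pot_ge mu t (d x) x) ->
  nearly_everywhere k E
    (fun x => pot_ge (fun f => s * nu f + r * mu f) t (s * c x + r * d x) x).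
Proof.
move=> t0 s0 r0 cc cd fnu fmu ne ne'; apply: nearly_everywhereI => tau et mfin tN.
have [pt _] := et.
have tE : null tau (~` E) by apply: nullS tN => x nE [].
have n1 := null_not_pot_ge t0 cc fnu ne et mfin tE.
have n2 := null_not_pot_ge t0 cd fmu ne' et mfin tE.
apply: nullS (nullU hX lX pt tN (nullU hX lX pt n1 n2)) => x _.
apply: contrapT => H.
have rnu : radon R X nu by case: fnu.
have rmu : radon R X mu by case: fmu.
have [fx gx] : pot_finite nu x /\ pot_ge nu t (c x) x.
  by apply: contrapT => h; apply: H; right; left.
have [fx' gx'] : pot_finite mu x /\ pot_ge mu t (d x) x.
  by apply: contrapT => h; apply: H; right; right.
apply: H; left => -[Ex]; apply.
have i1 := pot_integrates rnu fx; have i2 := pot_integrates rmu fx'.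
apply/(pot_geP _ _ (integrates_combo hX s r (minorized_sec hX mk x) i1 i2)).
have /(ler_wpM2l s0) := iffLR (pot_geP _ _ i1) gx.
have /(ler_wpM2l r0) := iffLR (pot_geP _ _ i2) gx'.
by lra.
Qed.

(** If the potentials differ by at least d on a closed F, integrating against the restriction of tau
    to F contradicts equality of the integrals unless that restriction is zero. *)
Lemma null_pot_neq tau rho rho' : pos_energy k tau ->
  pos_energy k rho -> pos_energy k rho' -> (mass tau < +oo)%E ->
  (forall sigma, pos_energy k sigma ->
     lsc_integral sigma (pot k rho) = lsc_integral sigma (pot k rho')) ->
  null tau [set x | pot k rho x = +oo \/ pot k rho' x = +oo \/
                    pot k rho x < pot k rho' x + 0%:E]%E.
Proof.
move=> et er er' mfin eqpot; have [pt _] := et.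
have [pr _] := er; have [pr' _] := er'.
apply: (@null_pot_lt tau rho rho' (fun=> 0)) => //; first exact: cst_continuous.
move=> F d cF d0 HF f Cf f0.
set sigma := restriction tau F; have ps : radon_pos R X sigma := restriction_pos hX lX F pt.
have es : pos_energy k sigma.
  by apply: (pos_energy_le hX lX kk ps _ et); exact: restriction_le.
have [b b0 fb] := Cc_bounded hX Cf; have b1 : 0 < b + 1 by lra.
(* This factor scales f below the gap d, so that [d / (b + 1) * f] can be added to a minorant of one
   potential while staying below the other on F. *)
have db : 0 < d / (b + 1) by exact: divr_gt0.
have := pot_integral_fin hX lX kk pk er es.
have := lsc_integral_gt sigma (pot_minorized hX mk pr).
case EU : (lsc_integral sigma (pot k rho)) => [U||] // _ _.
suff H e : 0 < e -> d / (b + 1) * sigma f < e.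
  apply/eqP; rewrite eq_le (pos_ge0 ps) // andbT leNgt; apply/negP => s0.
  by have := H _ (mulr_gt0 db s0); rewrite ltxx.
move=> e0; have : ((U - e)%:E < lsc_integral sigma (pot k rho))%E.
  by rewrite EU lte_fin; lra.
move=> /lt_lsc_integral[w [Cw wu Uw]]; have Cdf := CcZ hX (d / (b + 1)) Cf.
have : ((sigma (fun x => d / (b + 1) * f x + w x))%:E <= U%:E)%E.
  rewrite -EU (eqpot _ es); apply: (restriction_le_lsc hX lX pt cF).
  - exact: (pot_lsc hX lX lk mk).
  - exact: (pot_minorized hX mk).
  - exact: CcD.
  move=> x Fx; have [_ _] := HF x Fx; rewrite adde0; apply: le_trans.
  rewrite addrC EFinD; apply: leeD; first exact: wu.
  rewrite lee_fin mulrAC ler_pdivrMr // ler_pM2l //.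
  by have := fb x; have := ler_norm (f x); lra.
by rewrite (radon_lin _ (pos_radon ps)) // lee_fin; lra.
Qed.

Lemma pos_energy_add mu nu : pos_energy k mu -> pos_energy k nu ->
  pos_energy k (mu \+ nu).
Proof.
move=> em en; have [pm _] := em; have [pn _] := en.
apply/(pos_energyP hX lX kk); first exact: pos_add.
have fm := iffRL (pos_energyP hX lX kk pm) em.
have fn := iffRL (pos_energyP hX lX kk pn) en.
have := finite_energy_combo hX lX kk pk 1 1 fm fn.
by congr finite_energy; apply/funext => f; rewrite !mul1r.
Qed.

(** Regrouping nu - mu as (nu^+ + mu^-) - (nu^- + mu^+) leaves potentials of positive measures,
    which are always defined. Applying [null_pot_neq] in both orders gives equality of these
    potentials almost everywhere for each test measure. *)
Lemma nearly_everywhere_equivalent E nu mu t (c : X -> R) : t != 0 ->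
  continuous c -> finite_energy k nu -> finite_energy k mu ->
  knorm2 k (nu \- mu) = 0%E ->
  nearly_everywhere k E (fun x => pot_ge mu t (c x) x) ->
  nearly_everywhere k E (fun x => pot_ge nu t (c x) x).
Proof.
move=> t0 cc fnu fmu d0 ne; apply: nearly_everywhereI => tau et mfin tN.
have [pt _] := et.
have tE : null tau (~` E) by apply: nullS tN => x nE [].
have n0 := null_not_pot_ge t0 cc fmu ne et mfin tE.
have rnu : radon R X nu by case: fnu.
have rmu : radon R X mu by case: fmu.
have [ep en] := pos_energy_jordan hX lX kk fnu.
have [ep' en'] := pos_energy_jordan hX lX kk fmu.
have er := pos_energy_add ep en'; have er' := pos_energy_add en ep'.
have dE : nu \- mu = (jpos nu \+ jneg mu) \- (jneg nu \+ jpos mu).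
  apply/funext => f; rewrite /= {1}(jordanE hX lX rnu) {1}(jordanE hX lX rmu) /=.
  by lra.
have eqpot sigma : pos_energy k sigma -> lsc_integral sigma (pot k (jpos nu \+ jneg mu))
    = lsc_integral sigma (pot k (jneg nu \+ jpos mu)).
  by move=> es; apply: (equivalent_potentials hX lX kk pk) => //; rewrite -dE.
have n1 := null_pot_neq et er er' mfin eqpot.
have n2 := null_pot_neq et er' er mfin (fun s es => esym (eqpot s es)).
apply: nullS (nullU hX lX pt tN (nullU hX lX pt n0 (nullU hX lX pt n1 n2))) => x _.
apply: contrapT => H.
have [fx gx] : pot_finite mu x /\ pot_ge mu t (c x) x.
  by apply: contrapT => h; apply: H; right; left.
apply: H.
have ms := minorized_sec hX mk x.
have potD m m' : radon_pos R X m -> radon_pos R X m' ->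
    pot k (m \+ m') x = (pot k m x + pot k m' x)%E.
  by move=> pm pm'; exact: lsc_integralD.
have [[pp _] [pn _] [pp' _] [pn' _]] := And4 ep en ep' en'.
have [/pot_fin_num up' /pot_fin_num un'] := fx.
have := lsc_integral_gt (jpos nu) ms; have := lsc_integral_gt (jneg nu) ms.
rewrite -/(pot k _ x) -/(pot k (jpos nu) x) /= !potD // un' up'.
case En : (pot k (jneg nu) x) => [n||] // _; last first.
  by move=> _; right; right; left; right; left.
case Ep : (pot k (jpos nu) x) => [p||] // _; last first.
  by right; right; left; left.
have [h|h|h] := ltgtP (p + fine (pot k (jneg mu) x)) (n + fine (pot k (jpos mu) x)).
- by right; right; left; right; right; rewrite -!EFinD lte_fin addr0.
- by right; right; right; right; right; rewrite -!EFinD lte_fin addr0.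
left => -[Ex]; apply.
have fx' : pot_finite nu x by rewrite /pot_finite En Ep !ltry.
apply/(pot_geP _ _ (pot_integrates rnu fx')).
have := iffLR (pot_geP _ _ (pot_integrates rmu fx)) gx.
rewrite En Ep /=; suff -> : fine (pot k (jpos mu) x) - fine (pot k (jneg mu) x) = p - n by [].
by lra.
Qed.

End nearly_everywhere.

(** * Minimizers *)

Section minimizers.
Context {R : realType} {X : topologicalType} (hX : hausdorff_space X)
  (lX : locally_compact [set: X]).
Variable k : X * X -> \bar R.
Hypotheses (kk : energy_kernel k) (pk : positive_definite k).
Variables (g : X -> R) (m p : nat) (a : 'I_(m + p) -> R) (A : 'I_(m + p) -> set X).
Hypotheses (cg : continuous g) (a_gt0 : forall i, 0 < a i).

Let weight_neq0 i : alpha i * a i != 0.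
Proof.
apply: mulf_neq0; last by rewrite gt_eqF.
by rewrite /alpha; case: ifP => _; rewrite ?oppr_eq0 oner_eq0.
Qed.

(** Midpoints are all the convexity that the parallelogram law requires; the constants [c] are
    averaged as well. *)
Lemma Gamma_hat_midpoint nu mu : Gamma_hat k A a g nu -> Gamma_hat k A a g mu ->
  Gamma_hat k A a g (fun f => 2^-1 * nu f + 2^-1 * mu f).
Proof.
move=> [fn [c [cn c1]]] [fm [d [dm d1]]]; split.
  exact: (finite_energy_combo hX lX kk pk).
exists (fun i => 2^-1 * c i + 2^-1 * d i); split; last first.
  by rewrite big_split /= -!mulr_sumr; lra.
move=> i; have h : (0 : R) <= 2^-1 by lra.
have := nearly_everywhere_combo hX lX kk pk (weight_neq0 i) h h
  (@continuousZf _ _ (c i) _ cg) (@continuousZf _ _ (d i) _ cg) fn fm (cn i) (dm i).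
congr nearly_everywhere; apply/funext => x; rewrite /pot_ge.
have -> // : 2^-1 * (c i * g x) + 2^-1 * (d i * g x) = (2^-1 * c i + 2^-1 * d i) * g x.
by lra.
Qed.

Lemma Gamma_hat_equivalent nu mu : finite_energy k nu ->
  Gamma_hat k A a g mu -> knorm2 k (nu \- mu) = 0%E -> Gamma_hat k A a g nu.
Proof.
move=> fn [fm [c [cm c1]]] d0; split; first exact: fn.
exists c; split; last exact: c1.
move=> i.
apply: (nearly_everywhere_equivalent hX lX kk pk (weight_neq0 i) _ fn fm d0 (cm i)).
exact: continuousZf.
Qed.

(** Along mu + t (nu - mu) the energy is affine in t, the quadratic coefficient being 0. It is
    nonnegative for all t, so its slope is 0; a nonzero slope B would give -1 at t = - (A' + 1) /
    B. *)
Lemma knorm2_equivalent nu mu : finite_energy k nu -> finite_energy k mu ->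
  knorm2 k (nu \- mu) = 0%E -> knorm2 k nu = knorm2 k mu.
Proof.
move=> fn fm d0; have fd := finite_energyB hX lX kk pk fn fm.
have [A' [B [C [EA EC _ _ Q]]]] := knorm2_combo hX lX kk pk fm fd.
have C0 : C = 0 by move: EC; rewrite d0 => -[].
have H t : 0 <= A' + t * B.
  have := knorm2_ge0 pk (finite_energy_combo hX lX kk pk 1 t fm fd).
  by rewrite Q lee_fin C0; lra.
have B0 : B = 0.
  apply/eqP; apply: contrapT => /negP Bn0; have := H (- (A' + 1) / B).
  by rewrite divfK //; lra.
have -> : nu = fun f => 1 * mu f + 1 * (nu \- mu) f.
  by apply/funext => f /=; lra.
by rewrite Q EA B0 C0; congr EFin; lra.
Qed.

(** Both energies equal A', and the midpoint has energy (2 A' + B) / 4, at least A' by minimality.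
    Hence B >= 2 A', and the energy 2 A' - B of the difference is at most 0. *)
Lemma G_hat_equivalent nu mu : G_hat k A a g nu -> G_hat k A a g mu ->
  knorm2 k (nu \- mu) = 0%E.
Proof.
move=> [Gn En] [Gm Em]; have [fn _] := Gn; have [fm _] := Gm.
have [A' [B [C [EA EC _ _ Q]]]] := knorm2_combo hX lX kk pk fn fm.
have AC : A' = C by move: EA; rewrite En -Em EC => -[].
have : (inf_energy k (Gamma_hat k A a g) <=
    knorm2 k (fun f => 2^-1 * nu f + 2^-1 * mu f)%R)%E.
  apply: ereal_inf_lbound; exists (fun f => 2^-1 * nu f + 2^-1 * mu f).
    exact: Gamma_hat_midpoint.
  exact: erefl.
rewrite -En EA Q lee_fin => h.
have QE : knorm2 k (nu \- mu) = (1 ^+ 2 * A' + 1 * (-1) * B + (-1) ^+ 2 * C)%:E.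
  by rewrite -Q; congr knorm2; apply/funext => f /=; lra.
have := knorm2_ge0 pk (finite_energyB hX lX kk pk fn fm).
rewrite QE lee_fin => h'; congr EFin; lra.
Qed.

End minimizers.

Theorem lemma6 (R : realType) (X : topologicalType)
  (hausX : hausdorff_space X) (lcX : locally_compact [set: X])
  (k : X * X -> \bar R) (kerk : energy_kernel k) (consk : consistent k)
  (g : X -> R) (contg : continuous g) (g_gt0 : forall x, 0 < g x)
  (m p : nat) (m_gt0 : (0 < m)%N)
  (a : 'I_(m + p) -> R) (a_gt0 : forall i, 0 < a i)
  (A : 'I_(m + p) -> set X) (condA : condenser A)
  (cap_gt0 : (0 < condenser_capacity k A a g)%E)
  (bounds : p = 0%N \/
     (0 < ereal_inf [set (g x)%:E | x in plates A])%E /\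
     (ereal_sup [set k (x, y) | x in plates_pos A & y in plates_neg A] < +oo)%E)
  (Gamma_fin : (inf_energy k (Gamma_hat k A a g) < +oo)%E)
  (omega : (X -> R) -> R) (Gomega : G_hat k A a g omega) :
  G_hat k A a g =
  [set nu | finite_energy k nu /\ knorm k (nu \- omega) = 0%E].
Proof.
have [pk _] := consk; have [Go Eo] := Gomega; have [fo _] := Go.
apply/seteqP; split=> [nu Gnu|nu /= [fn d0]].
  have [[fn _] _] := Gnu; split => //.
  apply/(knorm_eq0 pk); first exact: (finite_energyB hausX lcX kerk pk).
  exact: (G_hat_equivalent hausX lcX kerk pk contg a_gt0 Gnu Gomega).
have fd := finite_energyB hausX lcX kerk pk fn fo.
have {}d0 := iffLR (knorm_eq0 pk fd) d0.
split; first exact: (Gamma_hat_equivalent hausX lcX kerk pk contg a_gt0 fn Go d0).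
by rewrite -Eo; exact: (knorm2_equivalent hausX lcX kerk pk fn fo).
Qed.
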